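(* For all $n,d\ge 0$, there is a one-to-one correspondence between rooted planar maps with $n$ edges and outer face degree $d$, and normal planar terms (NPTs) $[x]t$ whose $R$-coloring $\pi$ has $n+1$ uses of rule (s) and $d+1$ outer neutral handles (i.e. $|\mathrm{ONH}(\pi)| = d+1$).
   Context: Rooted planar maps: a planar map is a connected graph (loops and multiple edges allowed) embedded in the oriented sphere so that the complement of vertices and edges is a union of open disks (faces), up to orientation-preserving homeomorphism. A dart is an edge with one of its two orientations; the face to the left of a dart is incident to it. The degree of a face is the number of darts incident to it (an isthmus bordering a face is counted twice). A rooted planar map is a planar map with a chosen root dart, up to root-preserving homeomorphism; the vertex map (one vertex, no edges, one face) is rooted by default. The outer face is the face to the left of the root dart (the unique face for the vertex map, whose outer face degree is $0$). Lambda terms: lambda skeletons are graded sets $\mathrm{SLam}(i)$, least such that $\_ \in \mathrm{SLam}(1)$; $p\in\mathrm{SLam}(j), q\in\mathrm{SLam}(k)\Rightarrow p(q)\in\mathrm{SLam}(j+k)$; $p\in\mathrm{SLam}(i+1)\Rightarrow \lambda\_.p\in\mathrm{SLam}(i)$. A planar lambda term with ordered list of free variables $\Gamma$ decorating $p$, $[\Gamma]t\in\Lambda_1^0(p)$, is defined by: $[x]x\in\Lambda_1^0(\_)$; from $[\Gamma]t\in\Lambda_1^0(p)$, $[\Delta]u\in\Lambda_1^0(q)$ infer $[\Gamma,\Delta]t(u)\in\Lambda_1^0(p(q))$; from $[x,\Gamma]t\in\Lambda_1^0(p)$ infer $[\Gamma]\lambda x.t\in\Lambda_1^0(\lambda\_.p)$;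 terms modulo renaming of variables. $\mathrm{SNeu}(i)$ and $\mathrm{SNF}(i)$ are defined by rules (v) $\_\in\mathrm{SNeu}(1)$; (a) $p\in\mathrm{SNeu}(j)$, $q\in\mathrm{SNF}(k)\Rightarrow p(q)\in\mathrm{SNeu}(j+k)$; (s) $p\in\mathrm{SNeu}(i)\Rightarrow p\in\mathrm{SNF}(i)$; ($\ell$) $p\in\mathrm{SNF}(i+1)\Rightarrow\lambda\_.p\in\mathrm{SNF}(i)$. A $B$-/$R$-coloring of a term is a derivation of its skeleton in $\mathrm{SNeu}$/$\mathrm{SNF}$. An NPT is a planar term $[x]t$ with exactly one free variable that has an $R$-coloring. A neutral handle of a term is a decomposition of it as a context with one marked occurrence of a neutral subterm, written $C[\langle n\rangle]$. For a neutral or normal planar term with coloring $\pi$, the list $\mathrm{ONH}(\pi)$ of outer neutral handles is defined inductively: for rule (v) on $[x]x$, $\mathrm{ONH}=(\langle x\rangle)$; if $\pi$ ends with (a) deriving $[\Gamma,\Delta]t(u)$ from a $B$-coloring $\pi_1$ of $[\Gamma]t$ and an $R$-coloring $\pi_2$ of $[\Delta]u$, $\mathrm{ONH}(\pi)$ consists of $\langle t(u)\rangle$, then $t(H)$ for $H\in\mathrm{ONH}(\pi_2)$, then, only if $\Delta$ is empty, $H(u)$ for $H\in\mathrm{ONH}(\pi_1)$; if $\pi$ ends with (s) applied to $\pi_1$, $\mathrm{ONH}(\pi)=\mathrm{ONH}(\pi_1)$; if $\pi$ ends with ($\ell$) deriving $[\Gamma]\lambda x.t$ from $\pi_1$, $\mathrm{ONH}(\pi)$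 consists of $\lambda x.H$ for $H\in\mathrm{ONH}(\pi_1)$. *)

(* Defs.v *)
From mathcomp Require Import all_boot all_fingroup.
Set Implicit Arguments. Unset Strict Implicit. Unset Printing Implicit Defensive.

(* Lambda terms, with de Bruijn indices (= terms modulo renaming).      *)
Inductive term : Type :=
| Var of nat
| App of term & term
| Lam of term.

(* Planar typing [Gamma]t.  A context is the ordered list of the free
   variables, each given by its de Bruijn index at the current depth.
   Rule (lambda): from [x,Gamma]t infer [Gamma]\x.t ; inside the body
   the bound variable x is index 0 and the outer ones are shifted. *)
Inductive planar : seq nat -> term -> Prop :=
| PVar k : planar [:: k] (Var k)
| PApp G D t u : planar G t -> planar D u -> uniq (G ++ D) ->
    planar (G ++ D) (App t u)
| PLam G t : planar (0 :: map S G) t -> planar G (Lam t).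

(* free variables (indices at depth 0) in order of occurrence; for a
   planar term [Gamma]t one has fvs t = Gamma *)
Fixpoint fvs (t : term) : seq nat :=
  match t with
  | Var k => [:: k]
  | App t u => fvs t ++ fvs u
  | Lam t => [seq k.-1 | k <- fvs t & k != 0]
  end.

(* Colorings: B-colorings (derivations in SNeu) and R-colorings
   (derivations in SNF) of (the skeleton of) a term. *)
Inductive neu : term -> Type :=
| RV k : neu (Var k)
| RA t u : neu t -> nf u -> neu (App t u)
with nf : term -> Type :=
| RS t : neu t -> nf t
| RL t : nf t -> nf (Lam t).

Fixpoint s_uses_neu t (p : neu t) : nat :=
  match p with
  | RV _ => 0
  | RA _ _ p1 p2 => s_uses_neu p1 + s_uses_nf p2
  end
with s_uses_nf t (p : nf t) : nat :=
  match p with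
  | RS _ p1 => (s_uses_neu p1).+1
  | RL _ p1 => s_uses_nf p1
  end.

(* one-hole contexts; a neutral handle C[<n>] is a pair (C, n) *)
Inductive ctx : Type :=
| Hole
| CAppL of ctx & term
| CAppR of term & ctx
| CLam of ctx.

Definition handle := (ctx * term)%type.

Fixpoint ONH_neu t (p : neu t) : seq handle :=
  match p with
  | RV k => [:: (Hole, Var k)]
  | RA t u p1 p2 =>
      (Hole, App t u)
        :: [seq (CAppR t H.1, H.2) | H <- ONH_nf p2]
        ++ (if fvs u == [::] then [seq (CAppL H.1 u, H.2) | H <- ONH_neu p1]
            else [::])
  end
with ONH_nf t (p : nf t) : seq handle :=
  match p with
  | RS _ p1 => ONH_neu p1
  | RL _ p1 => [seq (CLam H.1, H.2) | H <- ONH_nf p1]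
  end.

Definition NPT_nd (n d : nat) (t : term) : Prop :=
  planar [:: 0] t /\
  exists pi : nf t, s_uses_nf pi = n.+1 /\ size (ONH_nf pi) = d.+1.

(* Rooted planar maps as combinatorial maps.                            *)
(* A map with m.+1 edges has darts 'I_(2*(m.+1)); sigma is the rotation *)
(* (counterclockwise) of darts around their origin vertex, alpha the    *)
(* edge involution, phi := sigma^-1 o alpha maps a dart to the next     *)
(* dart of the face on its left.  The vertex map is a separate case.    *)
Inductive rmap : Type :=
| VertexMap
| DartMap (m : nat) (sigma alpha : {perm 'I_(2 * m.+1)}) (root : 'I_(2 * m.+1)).

Definition face_perm m (sigma alpha : {perm 'I_(2 * m.+1)}) :=
  (alpha * sigma^-1)%g.   (* x |-> sigma^-1 (alpha x) *)

Definition valid_rmap (M : rmap) : Prop :=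
  match M with
  | VertexMap => True
  | DartMap m sigma alpha root =>
      (forall x, alpha (alpha x) = x) /\ (forall x, alpha x != x) /\
      (forall x y, connect (fun a b => (b == sigma a) || (b == alpha a)) x y) /\
      (* Euler: V - E + F = 2 *)
      #|porbits sigma| + #|porbits (face_perm sigma alpha)|
        = #|porbits alpha| + 2
  end.

Definition nedges (M : rmap) : nat :=
  match M with
  | VertexMap => 0
  | DartMap m sigma alpha _ => #|porbits alpha|
  end.

Definition outer_degree (M : rmap) : nat :=
  match M with
  | VertexMap => 0
  | DartMap m sigma alpha root => #|porbit (face_perm sigma alpha) root|
  end.

Definition map_iso (M1 M2 : rmap) : Prop :=
  match M1, M2 with
  | VertexMap, VertexMap => True
  | DartMap m1 s1 a1 r1, DartMap m2 s2 a2 r2 =>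
      exists f : 'I_(2 * m1.+1) -> 'I_(2 * m2.+1),
        bijective f /\ f r1 = r2 /\
        (forall x, f (s1 x) = s2 (f x)) /\ (forall x, f (a1 x) = a2 (f x))
  | _, _ => False
  end.

(* Main.v *)
Require Import Defs.
From mathcomp Require Import all_boot all_fingroup zify.
From Stdlib Require Import ClassicalEpsilon.
Set Implicit Arguments. Unset Strict Implicit. Unset Printing Implicit Defensive.

(** Both families are generated by Tutte's root-edge recursion, recorded by the
    type [tree].  An edgeless map is a [Leaf]; if the root edge is an isthmus its
    removal leaves two rooted maps ([Isthmus]); otherwise it leaves one map of
    outer degree d', and the edge can be put back in d' + 1 ways, distinguished
    by the new outer degree 1 <= k <= d' + 1 ([Loop _ k]).

    On terms, look at the last free variable z of an NPT [z]t.  If z is applied,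
    then t arises from an NPT t1 by replacing z by z(\y.t2) for an NPT [y]t2
    (isthmus); otherwise either t = z, or z is the argument of some n(z), and
    erasing z together with the outermost abstraction leaves an NPT in which n
    is an outer neutral handle (loop).  Inserting n(z) at the j-th outer handle,
    counted from 0, leaves exactly j + 2 outer handles, which matches the outer
    degree k = j + 1.

    On maps, deletions are multiplications by transpositions, so they take place
    on a fixed set of darts.  Each of them changes the numbers of cycles and of
    components in a controlled way; hence the genus is nonnegative and planarity
    survives deletions, and in a planar map the root edge is an isthmus exactly
    when its two sides belong to the same face. *)

(** * Trees and normal planar terms *)

Inductive tree : Type :=
| Leaf
| Isthmus of tree & tree
| Loop of tree & nat.

Fixpoint tedges (T : tree) : nat :=
  match T with
  | Leaf => 0
  | Isthmus T1 T2 => (tedges T1 + tedges T2).+1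
  | Loop T _ => (tedges T).+1
  end.

Fixpoint tdeg (T : tree) : nat :=
  match T with
  | Leaf => 0
  | Isthmus T1 T2 => (tdeg T1 + tdeg T2).+2
  | Loop _ k => k
  end.

Fixpoint tvalid (T : tree) : bool :=
  match T with
  | Leaf => true
  | Isthmus T1 T2 => tvalid T1 && tvalid T2
  | Loop T k => [&& tvalid T, 0 < k & k <= (tdeg T).+1]
  end.

(** * Colored skeletons and the two operations at the last free variable *)

Inductive sneu : Type := SV | SA of sneu & snf
with snf : Type := SS of sneu | SL of snf.

Scheme sneu_mind := Induction for sneu Sort Prop
with snf_mind := Induction for snf Sort Prop.
Combined Scheme skel_mind from sneu_mind, snf_mind.

(** The grading is computed instead of being an index, so that skeletons can be edited freely; [wfB]
    and [wfR] only record that every abstraction has a variable to bind. *)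
Fixpoint arB b := match b with SV => 1 | SA b r => arB b + arR r end
with arR r := match r with SS b => arB b | SL r => (arR r).-1 end.

Fixpoint wfB b := match b with SV => true | SA b r => wfB b && wfR r end
with wfR r := match r with SS b => wfB b | SL r => wfR r && (0 < arR r) end.

Fixpoint sB b := match b with SV => 0 | SA b r => sB b + sR r end
with sR r := match r with SS b => (sB b).+1 | SL r => sR r end.

(** Lengths of the lists [ONH_neu] and [ONH_nf]; the test [arR r == 0] says that the context of the
    argument is empty. *)
Fixpoint hB b :=
  match b with
  | SV => 1
  | SA b r => (hR r + (if arR r == 0 then hB b else 0)).+1
  end
with hR r := match r with SS b => hB b | SL r => hR r end.

Lemma arB_gt0 b : 0 < arB b.
Proof. by elim: b => //= b IH r; rewrite addn_gt0 IH. Qed.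

Lemma hB_gt0 b : 0 < hB b. Proof. by case: b. Qed.

(* [insB j b] replaces the j-th outer handle <n> of b by n(z), where z is a
   new last free variable. *)
Fixpoint insB j b :=
  match j, b with
  | 0, _ | _, SV => SA b (SS SV)
  | j.+1, SA b r => if j < hR r then SA b (insR j r) else SA (insB (j - hR r) b) r
  end
with insR j r :=
  match r with SS b => SS (insB j b) | SL r => SL (insR j r) end.

(* [subB w b] replaces the last free variable z of b by z(w). *)
Fixpoint subB w b :=
  match b with
  | SV => SA SV w
  | SA b r => if arR r == 0 then SA (subB w b) r else SA b (subR w r)
  end
with subR w r :=
  match r with SS b => SS (subB w b) | SL r => SL (subR w r) end.

(** The handles listed before the j-th survive, followed by [<n(z)>] and [<z>]. All later ones are
    lost, since they lie in the function part of an application whose argument now contains z. Hence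
    j + 2, whatever the former number was. *)
Lemma insP :
  (forall b j, wfB b -> j < hB b ->
     [/\ wfB (insB j b), arB (insB j b) = (arB b).+1,
         sB (insB j b) = (sB b).+1 & hB (insB j b) = j.+2]) /\
  (forall r j, wfR r -> j < hR r ->
     [/\ wfR (insR j r), arR (insR j r) = (arR r).+1,
         sR (insR j r) = (sR r).+1 & hR (insR j r) = j.+2]).
Proof.
apply: skel_mind => [|b IHb r IHr|b IHb|r IHr].
- by case.
- case=> [|j] /= /andP[wb wr]; first by rewrite wb wr !addn1.
  rewrite ltnS; case: (ltnP j (hR r)) => [lt_j _|le_j lt_j] /=.
    by have [-> -> -> ->] := IHr _ wr lt_j; rewrite wb !addnS addn0.
  case: eqP lt_j => [r0|_] lt_j; last by move: lt_j; rewrite addn0 ltnNge le_j.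
  have [|-> -> -> ->] := IHb (j - hR r) wb; first by lia.
  by rewrite wr r0; split=> //; lia.
- by move=> j /= wb lt_j; have [-> -> -> ->] := IHb _ wb lt_j.
- move=> j /= /andP[wr r0] lt_j; have [-> -> -> ->] := IHr _ wr lt_j.
  by split=> //=; lia.
Qed.

(** Only closed arguments stand to the right of z, so [<z>] is an outer handle. It is replaced by
    [<z(w)>], the handles of w and [<z>]; arities do not change, so all other handles stay. *)
Lemma subP w : wfR w -> arR w = 0 ->
  (forall b, wfB b ->
     [/\ wfB (subB w b), arB (subB w b) = arB b,
         sB (subB w b) = sB b + sR w & hB (subB w b) = (hB b + hR w).+1]) /\
  (forall r, wfR r -> 0 < arR r ->
     [/\ wfR (subR w r), arR (subR w r) = arR r,
         sR (subR w r) = sR r + sR w & hR (subR w r) = (hR r + hR w).+1]).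
Proof.
move=> ww w0; apply: skel_mind => [|b IHb r IHr|b IHb|r IHr] /=.
- by rewrite w0 ww /=; split=> //; lia.
- move=> /andP[wb wr]; case: eqP => r0 /=.
    have [-> -> -> ->] := IHb wb; rewrite wr r0 /=; split=> //; lia.
  have [|-> -> -> ->] := IHr wr; first lia.
  by rewrite wb; case: eqP => // _; split=> //; lia.
- by move=> wb _; have [-> -> -> ->] := IHb wb.
- move=> /andP[wr _] r2; have [|-> -> -> ->] := IHr wr; first lia.
  by split=> //; lia.
Qed.

(** Arities are preserved, so the path to z can be read off the result: taking different branches on
    the two sides would equate a closed argument with an open one, or an application with a
    variable. *)
Lemma sub_inj w w' : arR w = 0 -> arR w' = 0 -> wfR w -> wfR w' ->
  (forall b b', wfB b -> wfB b' -> subB w b = subB w' b' -> w = w' /\ b = b') /\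
  (forall r r', wfR r -> wfR r' -> 0 < arR r -> 0 < arR r' ->
     subR w r = subR w' r' -> w = w' /\ r = r').
Proof.
move=> w0 w0' ww ww'.
have [PB PR] := subP ww w0; have [PB' PR'] := subP ww' w0'.
apply: skel_mind => [|b IHb r IHr|b IHb|r IHr].
- case=> [|b' r'] /=; first by move=> _ _ [].
  case: eqP => r0 _ /andP[wb wr] [].
    by case: b' wb => [|? ?] //= _; case: ifP.
  move=> _ e; have [|_ e' _ _] := PR' r' wr; first lia.
  by rewrite -e w0 in e'; lia.
- case=> [|b' r'] /=.
    case: eqP => r0 /andP[wb wr] _ [].
      by case: b {IHb} wb => [|? ?] //= _; case: ifP.
    move=> _ e; have [|_ e' _ _] := PR r wr; first lia.
    by rewrite e w0' in e'; lia.
  move=> /andP[wb wr] /andP[wb' wr'].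
  case: eqP => r0; case: eqP => r0' [].
  + by move=> e ->; have [-> ->] := IHb _ wb wb' e.
  + move=> _ e; have [|_ e' _ _] := PR' r' wr'; first lia.
    by rewrite -e in e'; lia.
  + move=> _ e; have [|_ e' _ _] := PR r wr; first lia.
    by rewrite e in e'; lia.
  + by move=> -> e; have [||-> ->] := IHr _ wr wr' _ _ e; try lia.
- by case=> [b'|r'] //= wb wb' _ _ [e]; have [-> ->] := IHb _ wb wb' e.
- case=> [b'|r'] //= /andP[wr _] /andP[wr' _] ? ? [e].
  by have [||-> ->] := IHr _ wr wr' _ _ e; try lia.
Qed.

(** The path to the new variable is visible: an insertion inside an argument makes it open, whereas
    the function part has outer handles only behind a closed argument. An insertion at handle 0
    creates the argument [SS SV], which no insertion produces. *)
Lemma ins_inj :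
  (forall b j b' j', wfB b -> wfB b' -> j < hB b -> j' < hB b' ->
     insB j b = insB j' b' -> j = j' /\ b = b') /\
  (forall r j r' j', wfR r -> wfR r' -> j < hR r -> j' < hR r' ->
     insR j r = insR j' r' -> j = j' /\ r = r').
Proof.
have [PB PR] := insP.
have neqV r j : insR j r = SS SV -> False.
  by case: r => //= b []; case: j b => [|j] [|b r] //=; case: ifP.
have VnB b j : SS SV <> insR j b by move/esym/neqV.
apply: skel_mind => [|b IHb r IHr|b IHb|r IHr].
- case=> // [] [|b' r'] [|j'] //= _ /andP[wb wr] _; rewrite ltnS.
  case: (ltnP j' (hR r')) => [lt_j _ [_ e]|le_j lt_j [e er]]; first by case: (VnB _ _ e).
  by have := congr1 arR er; case: eqP lt_j => [->|_] //=; lia.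
- case=> [|j] [|b' r'] [|j'] /= wbr wbr'; move: (wbr) (wbr').
  + by [].
  + by [].
  + by move=> _ _ _ _ [<- <-].
  + move=> _ /andP[wb wr] _; rewrite ltnS.
    case: (ltnP j' (hR r')) => [lt_j _ [_ e]|le_j lt_j [e er]]; first by case: (VnB _ _ e).
    by have := congr1 arR er; case: eqP lt_j => [->|_] //=; lia.
  + move=> /andP[wb wr] _; rewrite ltnS.
    case: (ltnP j (hR r)) => [lt_j _ _ [_ e]|le_j lt_j _ [e er]]; first by case: (neqV _ _ e).
    by have := congr1 arR er; case: eqP lt_j => [->|_] //=; lia.
  + by [].
  + move=> /andP[wb wr] _; rewrite ltnS.
    case: (ltnP j (hR r)) => [lt_j _ _ [_ e]|le_j lt_j _ [e er]]; first by case: (neqV _ _ e).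
    by have := congr1 arR er; case: eqP lt_j => [->|_] //=; lia.
  + move=> /andP[wb wr] /andP[wb' wr']; rewrite !ltnS.
    case: (ltnP j (hR r)) => [lt_j _|le_j lt_j]; case: (ltnP j' (hR r')) => [lt_j' _|le_j' lt_j'] [].
    * by move=> -> e; have [-> ->] := IHr _ _ _ wr wr' lt_j lt_j' e.
    * move=> _ e; have [_ e' _ _] := PR _ _ wr lt_j; rewrite e in e'.
      by case: eqP lt_j' => [e0|_]; lia.
    * move=> _ e; have [_ e' _ _] := PR _ _ wr' lt_j'; rewrite -e in e'.
      by case: eqP lt_j => [e0|_]; lia.
    * move=> e er; subst r'; case: eqP lt_j lt_j' => [_|_]; last by lia.
      move=> lt_j lt_j'; have [||e1 ->] := IHb _ _ _ wb wb' _ _ e; [lia|lia|split=> //; lia].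
- by move=> j [b'|r'] j' //= wb wb' lj lj' [e]; have [-> ->] := IHb _ _ _ wb wb' lj lj' e.
- move=> j [b'|r'] j' //= /andP[wr _] /andP[wr' _] lj lj' [e].
  by have [-> ->] := IHr _ _ _ wr wr' lj lj' e.
Qed.

(** The last free variable is an argument after an insertion, and is applied after a
    substitution. *)
Lemma ins_neq_sub w : arR w = 0 -> wfR w ->
  (forall b j b', wfB b -> wfB b' -> j < hB b -> insB j b <> subB w b') /\
  (forall r j r', wfR r -> wfR r' -> j < hR r -> 0 < arR r' -> insR j r <> subR w r').
Proof.
move=> w0 ww; have [PB PR] := subP ww w0; have [_ QR] := insP.
have neqV r : subR w r = SS SV -> False.
  by case: r => //= b []; case: b => [|b r] //=; case: ifP.
apply: skel_mind => [|b IHb r IHr|b IHb|r IHr].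
- case=> // [] [|b' r'] //= _; first by move=> _ _ [] e; rewrite -e in w0.
  case/andP=> wb wr _; case: eqP => // r0 [_ er]; first by rewrite -er in r0.
  exact: (neqV r').
- case=> [|j] [|b' r'] //= /andP[wb wr].
  + move=> /andP[wb' wr'] _; case: eqP => // r0 [_ er]; last exact: (neqV r').
    by rewrite -er in r0.
  + rewrite ltnS => _; case: (ltnP j (hR r)) => [lj _ [_ e]|lj lj' [e _]].
      by have [_ e' _ _] := QR _ _ wr lj; rewrite e w0 in e'.
    by case: (j - _) b {IHb lj' wb} e => [|k] [|b r0] //=; case: ifP.
  + rewrite ltnS => /andP[wb' wr']; case: (ltnP j (hR r)) => [lj _|lj lj'];
      case: eqP => // r0 [].
    * by move=> _ e; have [_ e' _ _] := QR _ _ wr lj; rewrite e r0 in e'.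
    * by move=> _; apply: IHr => //; lia.
    * by move=> e _; case: eqP lj' => [?|?] lj'; [apply: IHb e => // | ]; lia.
    * move=> _ e; case: eqP lj' => [z|?] lj'; last lia.
      by have [|_ e' _ _] := PR r' wr'; [lia|]; rewrite -e z in e'; lia.
- by move=> j [b'|r'] //= wb wb' lj _ [/IHb]; apply.
- by move=> j [b'|r'] //= /andP[wr _] /andP[wr' _] lj ? [/IHr]; apply=> //; lia.
Qed.

(** The recursion follows the last free variable: into the argument if that is open, into the
    function part otherwise. *)
Lemma last_var_cases :
  (forall b, wfB b ->
    [\/ b = SV,
        exists w b', [/\ wfR w, arR w = 0, wfB b' & b = subB w b'] |
        exists j b', [/\ wfB b', j < hB b' & b = insB j b']]) /\
  (forall r, wfR r -> 0 < arR r ->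
    [\/ r = SS SV,
        exists w r', [/\ wfR w, arR w = 0, wfR r', 0 < arR r' & r = subR w r'] |
        exists j r', [/\ wfR r', j < hR r' & r = insR j r']]).
Proof.
have [QB QR] := insP.
apply: skel_mind => [|b IHb r IHr|b IHb|r IHr] /=.
- by constructor 1.
- case/andP=> wb wr; case: (posnP (arR r)) => r0.
    case: (IHb wb) => [->|[w [b' [ww w0 wb' ->]]]|[j [b' [wb' lj ->]]]].
    + by constructor 2; exists r, SV.
    + by constructor 2; exists w, (SA b' r); rewrite /= r0 wb' wr.
    (* The handles of the function part come after the whole application and the [hR r] handles of
       its closed argument. *)
    + constructor 3; exists (hR r + j).+1, (SA b' r); rewrite /= wb' wr.
      by rewrite ltnS ltn_add2l r0 lj ltnNge leq_addr /= addKn.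
  case: (IHr wr r0) => [->|[w [r' [ww w0 wr' r0' ->]]]|[j [r' [wr' lj ->]]]].
  + by constructor 3; exists 0, b; rewrite hB_gt0; split=> //; case: (b).
  + constructor 2; exists w, (SA b r'); rewrite /= wb wr'; split=> //.
    by case: eqP r0' => // ->.
  + by constructor 3; exists j.+1, (SA b r'); rewrite /= wb wr' lj ltnS ltn_addr.
- move=> wb _; case: (IHb wb) => [->|[w [b' [ww w0 wb' ->]]]|[j [b' [wb' lj ->]]]].
  + by constructor 1.
  + by constructor 2; exists w, (SS b'); rewrite /= wb' arB_gt0.
  + by constructor 3; exists j, (SS b').
- case/andP=> wr _ r2.
  have r1 : 0 < arR r by lia.
  case: (IHr wr r1) => [e|[w [r' [ww w0 wr' r0' e]]]|[j [r' [wr' lj e]]]].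
  + by rewrite e in r2.
  + have [_ PR] := subP ww w0; have [_ e' _ _] := PR r' wr' r0'; subst r.
    by constructor 2; exists w, (SL r'); rewrite /= wr' r0'; split=> //; lia.
  + have [_ e' _ _] := QR _ _ wr' lj; subst r.
    by constructor 3; exists j, (SL r'); rewrite /= wr' lj; split=> //; lia.
Qed.

(** In the isthmus case [SL] closes the second term, which becomes the argument of z. In the loop
    case it binds the former free variable, so that the inserted one is the only free variable
    left. *)
Fixpoint skel_of_tree (T : tree) : snf :=
  match T with
  | Leaf => SS SV
  | Isthmus T1 T2 => subR (SL (skel_of_tree T2)) (skel_of_tree T1)
  | Loop T k => SL (insR k.-1 (skel_of_tree T))
  end.

Lemma skel_of_treeP T : tvalid T ->
  [/\ wfR (skel_of_tree T), arR (skel_of_tree T) = 1,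
      sR (skel_of_tree T) = (tedges T).+1 & hR (skel_of_tree T) = (tdeg T).+1].
Proof.
elim: T => [|T1 IH1 T2 IH2|T IH k] //=.
  case/andP=> /IH1[w1 a1 s1 h1] /IH2[w2 a2 s2 h2].
  have [||_ PR] := @subP (SL (skel_of_tree T2)); rewrite /= ?w2 ?a2 //.
  by have [|-> -> -> ->] := PR _ w1; rewrite ?a1 //= s1 s2 h1 h2; split=> //; lia.
case/and3P=> /IH[w a s h] k0 lek; have [_ QR] := insP.
by have [|-> -> -> ->] := QR (skel_of_tree T) k.-1 w; rewrite ?a ?s ?h //; [lia|split=> //; lia].
Qed.

Lemma skel_of_tree_inj T T' : tvalid T -> tvalid T' ->
  skel_of_tree T = skel_of_tree T' -> T = T'.
Proof.
have sub1 T1 T2 : tvalid T1 -> tvalid T2 ->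
    [/\ wfR (SL (skel_of_tree T2)), arR (SL (skel_of_tree T2)) = 0,
        wfR (skel_of_tree T1) & 0 < arR (skel_of_tree T1)].
  by move=> /skel_of_treeP[w1 a1 _ _] /skel_of_treeP[w2 a2 _ _] /=; rewrite a1 a2 w2.
have subV w r : subR w r <> SS SV.
  by case: r => //= b []; case: b => [|b r] //=; case: ifP.
(* An isthmus and a loop never share a skeleton: both would start with an abstraction, and below it
   a substitution would equal an insertion. *)
have subins T1 T2 T0 k : tvalid T1 -> tvalid T2 -> tvalid T0 ->
    0 < k -> k <= (tdeg T0).+1 ->
    subR (SL (skel_of_tree T2)) (skel_of_tree T1) = SL (insR k.-1 (skel_of_tree T0)) -> False.
  move=> v1 v2 v0 k0 lek; have [w2 a2 w1 a1] := sub1 _ _ v1 v2.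
  have [w0 a0 _ h0] := skel_of_treeP v0; have [_ N] := ins_neq_sub a2 w2.
  case: (skel_of_tree T1) w1 a1 => [b|r] //= /andP[wr _] a1 [e].
  by apply: (N _ _ _ w0 wr _ _ (esym e)); lia.
elim: T T' => [|T1 IH1 T2 IH2|T IH k] [|T1' T2'|T' k'] //=.
- by move=> _ _ /esym/subV.
- by move=> _ _ /subV.
- case/andP=> v1 v2 /andP[v1' v2'] e.
  have [w2 a2 w1 a1] := sub1 _ _ v1 v2; have [w2' a2' w1' a1'] := sub1 _ _ v1' v2'.
  have [_ I] := sub_inj a2 a2' w2 w2'.
  by have [[/IH2 -> //] /IH1 -> //] := I _ _ w1 w1' a1 a1' e.
- by case/andP=> v1 v2 /and3P[v0 k0 lek] /subins; case.
- by case/and3P=> v0 k0 lek /andP[v1 v2] /esym/subins; case.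
- case/and3P=> v k0 lek /and3P[v' k0' lek'] [e].
  have [w a _ h] := skel_of_treeP v; have [w' a' _ h'] := skel_of_treeP v'.
  have [_ I] := ins_inj; have [||ek eT] := I _ _ _ _ w w' _ _ e; [lia|lia|].
  by rewrite (IH _ v v' eT); congr Loop; lia.
Qed.

Lemma skel_of_tree_surj r : wfR r -> arR r = 1 ->
  exists2 T, tvalid T & skel_of_tree T = r.
Proof.
(* Strong induction on the uses of rule (s), of which every normal skeleton has at least one; hence
   both parts of an isthmus are smaller than the whole. *)
elim: {r}(sR r).+1 {-2}r (ltnSn (sR r)) => // m IH r ler wr r1.
have [_ C] := last_var_cases; have [QB QR] := insP.
have [|e|[w [r' [ww w0 wr' r0' e]]]|[j [r' [wr' lj e]]]] := C r wr; first lia.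
- by exists Leaf.
- have [_ PR] := subP ww w0; have [_ a' s' _] := PR _ wr' r0'; subst r.
  (* A closed normal skeleton must be an abstraction, since neutral ones have positive arity; its
     body has arity 1, as the induction requires. *)
  case: w ww w0 {C PR wr} s' ler a' r1 => [b _ /= b0|w /= /andP[ww w1] w0 s' ler a' r1].
    by have := arB_gt0 b; rewrite b0.
  have sw : 0 < sR w by elim: (w).
  have sr : 0 < sR r' by elim: (r').
  have [||T1 v1 e1] := IH r' _ wr'; [lia|lia|].
  have [||T2 v2 e2] := IH w _ ww; [lia|lia|].
  by exists (Isthmus T1 T2); rewrite /= ?v1 ?v2 ?e1 ?e2.
- have [_ a' s' _] := QR _ _ wr' lj; rewrite -e in a' s'.
  have a0 : arR r' = 0 by lia.
  case: r' e wr' lj a0 {a'} s' => [b|r'] /= e; first by have := arB_gt0 b; lia.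
  case/andP=> wr' r0' lj a0 s'.
  have [||T vT eT] := IH r' _ wr'; [lia|lia|].
  have [_ _ _ hT] := skel_of_treeP vT; rewrite eT in hT.
  by exists (Loop T j.+1); rewrite /= ?vT ?eT //=; lia.
Qed.

(** * Decorating skeletons with variables, and erasing them again *)

Fixpoint decB b (G : seq nat) : term :=
  match b with
  | SV => Var (head 0 G)
  | SA b r => App (decB b (take (arB b) G)) (decR r (drop (arB b) G))
  end
with decR r G :=
  match r with SS b => decB b G | SL r => Lam (decR r (0 :: map S G)) end.

Fixpoint eraseB t (p : neu t) : sneu :=
  match p with RV _ => SV | RA _ _ p1 p2 => SA (eraseB p1) (eraseR p2) end
with eraseR t (p : nf t) : snf :=
  match p with RS _ p1 => SS (eraseB p1) | RL _ p1 => SL (eraseR p1) end.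

Scheme neu_mind := Induction for neu Sort Prop
with nf_mind := Induction for nf Sort Prop.
Combined Scheme coloring_mind from neu_mind, nf_mind.

(** Turns the test on [fvs u] in [ONH_neu] into emptiness of the context of [u]. *)
Lemma planar_fvs G t : planar G t -> fvs t = G.
Proof.
elim=> [k|{}G D {}t u _ IHt _ IHu _|{}G {}t _ IH] //=; first by rewrite IHt IHu.
rewrite {}IH /=.
have -> : [seq k <- [seq i.+1 | i <- G] | k != 0] = map S G.
  by elim: G => //= k G ->.
by rewrite -map_comp map_id_in.
Qed.

Lemma erase_s :
  (forall t (p : neu t), s_uses_neu p = sB (eraseB p)) /\
  (forall t (p : nf t), s_uses_nf p = sR (eraseR p)).
Proof. by apply: coloring_mind => //= [t u p -> q ->|t p ->]. Qed.

(** Planarity leaves no choice of variables: their order in the context dictates where each one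
    occurs. *)
Lemma erase_planar :
  (forall t (p : neu t) G, planar G t ->
     [/\ wfB (eraseB p), arB (eraseB p) = size G, t = decB (eraseB p) G
       & size (ONH_neu p) = hB (eraseB p)]) /\
  (forall t (p : nf t) G, planar G t ->
     [/\ wfR (eraseR p), arR (eraseR p) = size G, t = decR (eraseR p) G
       & size (ONH_nf p) = hR (eraseR p)]).
Proof.
apply: coloring_mind => [k|t u p IHp q IHq|t p IHp|t p IHp] G P.
- by inversion P.
- inversion P as [|G' D t' u' Pt Pu U|]; subst.
  have [w1 a1 e1 h1] := IHp _ Pt; have [w2 a2 e2 h2] := IHq _ Pu.
  rewrite /= w1 w2 a1 a2 size_cat take_size_cat // drop_size_cat // -e1 -e2.
  split=> //; rewrite size_cat !size_map (planar_fvs Pu) h2 -size_eq0.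
  by case: ifP => _; rewrite ?size_map ?h1.
- exact: IHp.
- inversion P as [| |G' t' Pt]; subst.
  have [/= w a e h] := IHp _ Pt; rewrite w a -e size_map; split=> //.
  by rewrite size_map h.
Qed.

Lemma planar_dec :
  (forall b G, wfB b -> arB b = size G -> uniq G ->
     planar G (decB b G) /\ exists p : neu (decB b G), eraseB p = b) /\
  (forall r G, wfR r -> arR r = size G -> uniq G ->
     planar G (decR r G) /\ exists p : nf (decR r G), eraseR p = r).
Proof.
apply: skel_mind => [|b IHb r IHr|b IHb|r IHr].
(* The arity hypothesis makes [G] a singleton, so the default of [head] is never taken. *)
- by case=> [|k []] //= _ _ _; split; [constructor|exists (RV k)].
- move=> G /= /andP[wb wr] sG uG.
  move: (uG); rewrite -{1}(cat_take_drop (arB b) G) cat_uniq => /and3P[u1 _ u2].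
  have [|Pb [p ep]] := IHb (take (arB b) G) wb _ u1.
    by rewrite size_take -sG; case: ltnP => //; lia.
  have [|Pr [q eq]] := IHr (drop (arB b) G) wr _ u2.
    by rewrite size_drop -sG addKn.
  split; last by exists (RA p q); rewrite /= ep eq.
  by rewrite -{1}(cat_take_drop (arB b) G); constructor; rewrite ?cat_take_drop.
- move=> G /= wb sG uG; have [Pb [p ep]] := IHb G wb sG uG.
  by split=> //; exists (RS p); rewrite /= ep.
- move=> G /= /andP[wr r0] sG uG; have [||Pr [p ep]] := IHr (0 :: map S G) wr.
  + by rewrite /= size_map -sG prednK.
  + rewrite /= map_inj_uniq ?uG ?andbT; last exact: succn_inj.
    by apply/mapP=> [[]].
  by split; [constructor|exists (RL p); rewrite /= ep].
Qed.

(** The shape of the term shows the skeleton, whatever the variables: a neutral term is never an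
    abstraction, so (s) and (l) cannot be confused. *)
Lemma dec_inj :
  (forall b b' G G', decB b G = decB b' G' -> b = b') /\
  (forall r r' G G', decR r G = decR r' G' -> r = r').
Proof.
apply: skel_mind => [|b IHb r IHr|b IHb|r IHr].
- by case.
- by case=> //= b' r' G G' [/IHb-> /IHr->].
- by case=> [b'|r'] G G' /= e; [rewrite (IHb _ _ _ e)|case: b e {IHb}].
- by case=> [b'|r'] G G' /= => [|[/IHr->]] //; case: b'.
Qed.

Definition term_of_tree T := decR (skel_of_tree T) [:: 0].

Lemma term_of_tree_inj T T' : tvalid T -> tvalid T' ->
  term_of_tree T = term_of_tree T' -> T = T'.
Proof.
move=> v v' e; apply: skel_of_tree_inj => //.
by have [_ I] := dec_inj; apply: I e.
Qed.

Lemma NPT_ndP n d t :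
  NPT_nd n d t <->
  exists T, [/\ tvalid T, tedges T = n, tdeg T = d & t = term_of_tree T].
Proof.
have [_ Er] := erase_planar; have [_ Es] := erase_s.
split=> [[P [p [s h]]]|[T [vT eT dT ->]]].
  have [w a e h'] := Er _ p _ P.
  have [T vT rT] := skel_of_tree_surj w a.
  have [_ _ sT hT] := skel_of_treeP vT.
  exists T; split=> //; last by rewrite /term_of_tree rT.
    by move: s; rewrite Es -rT sT => -[].
  by move: h; rewrite h' -rT hT => -[].
have [w a s h] := skel_of_treeP vT.
have [_ Pd] := planar_dec; have [|P [p ep]] := Pd _ [:: 0] w a; first by [].
have [_ _ _ h'] := Er _ p _ P.
by split=> //; exists p; rewrite Es h' ep s h eT dT.
Qed.

(** * Genus of a pair of permutations *)

Local Open Scope group_scope.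

Lemma permMA (D : finType) (p q r : {perm D}) : p * (q * r) = p * q * r.
Proof. exact: mulgA. Qed.

Lemma tperm_mulK (D : finType) (u v : D) (p : {perm D}) :
  tperm u v * (tperm u v * p) = p.
Proof. by rewrite permMA tperm2; apply/permP=> x; rewrite permM perm1. Qed.

(** * Components of a pair of permutations *)

Section Connectivity.
Variable D : finType.
Implicit Types (a b p q : {perm D}) (x y z u v : D).

Definition conn a b : rel D := connect (fun x y => (y == a x) || (y == b x)).

Lemma conn_refl a b x : conn a b x x.
Proof. exact: connect0. Qed.

Lemma conn_trans a b x y z : conn a b x y -> conn a b y z -> conn a b x z.
Proof. exact: connect_trans. Qed.

Lemma connl a b x y : conn a b x y -> conn a b x (a y).
Proof. by move=> h; apply: conn_trans h (connect1 _); rewrite eqxx. Qed.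

Lemma connr a b x y : conn a b x y -> conn a b x (b y).
Proof. by move=> h; apply: conn_trans h (connect1 _); rewrite eqxx orbT. Qed.

Lemma conn_ind a b x (P : pred D) :
  P x -> (forall y, P y -> P (a y)) -> (forall y, P y -> P (b y)) ->
  forall y, conn a b x y -> P y.
Proof.
move=> Px Pa Pb y /connectP[s]; elim/last_ind: s y => [y _ -> //|s z IH y].
rewrite rcons_path last_rcons => /andP[ps /orP e] ->.
by case: e => /eqP->; [apply: Pa|apply: Pb]; apply: IH.
Qed.

Lemma connX a b x y n : conn a b x y -> conn a b x ((a ^+ n) y).
Proof. by move=> h; rewrite permX; elim: n => //= n IH; apply: connl. Qed.

Lemma conn_sym a b x y : conn a b x y = conn a b y x.
Proof.
suff H x' y' : conn a b x' y' -> conn a b y' x' by apply/idP/idP; apply: H.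
(* By finite order, the inverse of a permutation is one of its powers, so steps can be undone. *)
have back p z : exists n, z = (p ^+ n) (p z).
  exists #[p].-1; rewrite -permM -expgS prednK ?order_gt0 //.
  by rewrite expg_order perm1.
apply: (conn_ind (P := fun z => conn a b z x')) => [|y'' h|y'' h].
- exact: conn_refl.
- by apply: conn_trans h; have [n {2}->] := back a y''; apply/connX/conn_refl.
- apply: conn_trans h; have [n {2}->] := back b y''.
  by rewrite permX; elim: n => [|n IH] /=; [apply: conn_refl|apply: connr].
Qed.

Lemma connlE a b x y : conn a b x (a y) = conn a b x y.
Proof.
apply/idP/idP => [h|]; last exact: connl.
by apply: conn_trans h _; rewrite conn_sym; apply/connl/conn_refl.
Qed.

Lemma connrE a b x y : conn a b x (b y) = conn a b x y.
Proof.
apply/idP/idP => [h|]; last exact: connr.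
by apply: conn_trans h _; rewrite conn_sym; apply/connr/conn_refl.
Qed.

Lemma conn_sub a b p q :
  (forall x, conn p q x (a x)) -> (forall x, conn p q x (b x)) ->
  forall x y, conn a b x y -> conn p q x y.
Proof.
move=> ha hb x; apply: conn_ind => [|y h|y h]; first exact: conn_refl.
  exact: conn_trans h (ha y).
exact: conn_trans h (hb y).
Qed.

Lemma connC a b : conn a b =2 conn b a.
Proof.
move=> x y; apply/idP/idP; apply: conn_sub => z;
  by [apply/connr/conn_refl | apply/connl/conn_refl].
Qed.

Lemma connV a b : conn a^-1 b^-1 =2 conn a b.
Proof.
suff H p q : forall x y, conn p^-1 q^-1 x y -> conn p q x y.
  by move=> x y; apply/idP/idP; [|rewrite -{1}[a]invgK -{1}[b]invgK]; apply: H.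
apply: conn_sub => z.
  by rewrite conn_sym -{2}[z](permKV p); apply/connl/conn_refl.
by rewrite conn_sym -{2}[z](permKV q); apply/connr/conn_refl.
Qed.

Lemma conn_porbit a b x y : y \in porbit (a * b) x -> conn a b x y.
Proof.
case/porbitP=> n ->; rewrite permX; elim: n => [|n IH] /=; first exact: conn_refl.
by rewrite permM; apply/connr/connl.
Qed.

Lemma porbit_ind p x (P : pred D) :
  P x -> (forall y, P y -> P (p y)) -> forall y, y \in porbit p x -> P y.
Proof.
by move=> Px Pp y /porbitP[n ->]; rewrite permX; elim: n => //= n /Pp.
Qed.

Lemma porbit_step p x y : y \in porbit p x -> p y \in porbit p x.
Proof.
by case/porbitP=> n ->; apply/porbitP; exists n.+1; rewrite expgSr permM.
Qed.

Lemma conn1_porbit p x y : conn 1 p x y = (y \in porbit p x).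
Proof.
apply/idP/idP => [|/porbitP[n ->]].
  apply: (conn_ind (P := mem (porbit p x))) => [|z h|z h] /=; rewrite ?perm1 //.
    exact: porbit_id.
  exact: porbit_step.
by rewrite connC; apply/connX/conn_refl.
Qed.

Definition ccls a b x := [set y | conn a b x y].
Definition ccs a b := [set ccls a b x | x in D].
Definition ncc a b := #|ccs a b|.

Lemma mem_ccs a b x : ccls a b x \in ccs a b.
Proof. exact: imset_f. Qed.

Lemma ccls_eq a b x y : (ccls a b x == ccls a b y) = conn a b x y.
Proof.
apply/eqP/idP => [e|h].
  by have: y \in ccls a b y by [rewrite inE conn_refl]; rewrite -e inE.
apply/setP=> z; rewrite !inE; apply/idP/idP; last exact: conn_trans.
by apply: conn_trans; rewrite conn_sym.
Qed.

(* The coarser partition is the image of the finer one under saturation. *)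
Lemma ccs_coarsen a b p q : (forall x y, conn a b x y -> conn p q x y) ->
  let F (A : {set D}) := \bigcup_(y in A) ccls p q y in
  (forall x, F (ccls a b x) = ccls p q x) /\ ccs p q = F @: ccs a b.
Proof.
move=> sub F; have FE x : F (ccls a b x) = ccls p q x.
  apply/setP=> z; apply/bigcupP/idP => [[y]|h].
    by rewrite !inE => /sub; apply: conn_trans.
  by exists x; rewrite ?inE ?conn_refl // in h *.
split=> //; apply/setP=> A; apply/imsetP/imsetP => [[x _ ->]|[B /imsetP[x _ ->] ->]].
  by exists (ccls a b x); rewrite ?mem_ccs ?FE.
by exists x; rewrite ?FE.
Qed.

Lemma ncc_le a b p q : (forall x y, conn a b x y -> conn p q x y) ->
  ncc p q <= ncc a b.
Proof. by case/ccs_coarsen=> _ e; rewrite /ncc e leq_imset_card. Qed.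

Lemma ncc_lt a b p q u v : (forall x y, conn a b x y -> conn p q x y) ->
  conn p q u v -> ~~ conn a b u v -> ncc p q < ncc a b.
Proof.
case/ccs_coarsen=> FE e huv nuv; rewrite /ncc e ltn_neqAle leq_imset_card andbT.
apply: contra nuv => /imset_injP I; rewrite -ccls_eq; apply/eqP.
by apply: I; rewrite ?mem_ccs // !FE; apply/eqP; rewrite ccls_eq.
Qed.

(** The only new link allowed is between the classes of u and v, so at most one merger takes
    place. *)
Lemma ncc_leS a b p q u v : (forall x y, conn a b x y -> conn p q x y) ->
  (forall x, [|| conn a b x (p x), conn a b u x && conn a b v (p x)
              | conn a b v x && conn a b u (p x)]) ->
  (forall x, conn a b x (q x)) ->
  ncc a b <= (ncc p q).+1.
Proof.
move=> sub hp hq; have [FE e] := ccs_coarsen sub.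
pose R x y := [|| conn a b x y, conn a b u x && conn a b v y
                | conn a b v x && conn a b u y].
have tr := @conn_trans a b.
have pqR x y : conn p q x y -> R x y.
  apply: (conn_ind (P := R x)) => [|z|z]; rewrite /R.
  - by rewrite conn_refl.
  - case/or3P=> [h|/andP[h h']|/andP[h h']]; case/or3P: (hp z) => [k|/andP[k k']|/andP[k k']].
    + by rewrite (tr _ _ _ h k).
    + have -> := tr _ _ x k _; rewrite ?k' ?orbT // conn_sym //.
    + have -> := tr _ _ x k _; rewrite ?k' ?orbT // conn_sym //.
    + by rewrite h (tr _ _ _ h' k) ?orbT.
    + by rewrite h k' orbT.
    + have -> // := tr x _ _ _ k'; rewrite conn_sym //.
    + by rewrite h (tr _ _ _ h' k) ?orbT.
    + have -> // := tr x _ _ _ k'; rewrite conn_sym //.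
    + by rewrite h k' !orbT.
  - case/or3P=> [h|/andP[h h']|/andP[h h']].
    + by rewrite (tr _ _ _ h (hq z)).
    + by rewrite h (tr _ _ _ h' (hq z)) ?orbT.
    + by rewrite h (tr _ _ _ h' (hq z)) ?orbT.
(* Once the class of v is removed, saturation is injective on the remaining classes. *)
rewrite /ncc (cardsD1 (ccls a b v)) mem_ccs add1n ltnS e.
rewrite -(@card_in_imset _ _ 
  (fun A : {set D} => \bigcup_(y in A) ccls p q y) (ccs a b :\ ccls a b v)).
  by apply/subset_leq_card/imsetS/subD1set.
move=> A B /setD1P[nA /imsetP[x _ eA]] /setD1P[nB /imsetP[y _ eB]].
rewrite eA eB !FE => /eqP; rewrite ccls_eq => /pqR; rewrite /R => H.
rewrite eA ccls_eq conn_sym in nA; rewrite eB ccls_eq conn_sym in nB.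
by apply/eqP; rewrite ccls_eq; move: H; rewrite (negPf nA) (negPf nB) !(andbF, andFb, orbF).
Qed.

End Connectivity.

(** * Genus zero under multiplication by transpositions *)

Section Planarity.
Variable D : finType.
Implicit Types (a b p q : {perm D}) (x y z u v : D).

Definition nc p := #|porbits p|.

(** Euler's formula summed over components. For a connected pair with [a] a fixed-point-free
    involution, #|D| is twice the number of edges and this reads V - E + F = 2; fixed points of [a]
    (legs) and several components are allowed too. *)
Definition planar_pair a b := nc a + nc b + nc (a * b) == #|D| + (ncc a b).*2.

Lemma tpermM_conn a b u v x :
  [|| conn (tperm u v * a) b x (a x),
      conn (tperm u v * a) b u x && conn (tperm u v * a) b v (a x)
    | conn (tperm u v * a) b v x && conn (tperm u v * a) b u (a x)].
Proof.
set a' := tperm u v * a.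
have e y : a y = a' (tperm u v y) by rewrite permM tpermK.
rewrite !e; case: tpermP => [->|->|_ _]; rewrite !connlE !conn_refl ?orbT //.
Qed.

(** The transposition cuts the common cycle of u and v, or joins their two cycles; the count changes
    by one, written without subtraction. *)
Lemma nc_tperm u v p : u != v ->
  nc (tperm u v * p) + (u \notin porbit p v).*2 = (nc p).+1.
Proof. by move=> nuv; rewrite /nc porbits_mul_tperm nuv addn1. Qed.

Lemma tperm_sub a b u v : conn a b u v ->
  forall x y, conn (tperm u v * a) b x y -> conn a b x y.
Proof.
move=> huv; apply: conn_sub => x; last exact/connr/conn_refl.
by rewrite permM connlE; case: tpermP => [->|->|_ _]; rewrite ?conn_refl // conn_sym.
Qed.

Lemma conn_tperm_join a b u v : u \notin porbit a v -> conn (tperm u v * a) b u v.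
Proof.
move=> nuv; have [e|n_uv] := eqVneq u v; first by rewrite e porbit_id in nuv.
have := nc_tperm (tperm u v * a) n_uv; have := nc_tperm a n_uv.
rewrite tperm_mulK nuv => e1 e2.
have: u \in porbit (tperm u v * a) v by move: e2; case: (u \in _) => //=; lia.
rewrite porbit_sym -conn1_porbit; apply: conn_sub => x.
  by rewrite perm1 conn_refl.
exact/connl/conn_refl.
Qed.

Lemma conn_porbitl a b x y : y \in porbit a x -> conn a b x y.
Proof.
by rewrite -conn1_porbit; apply: conn_sub => z; rewrite ?perm1 ?conn_refl // connlE conn_refl.
Qed.

(* #|D| + 2 ncc a b - nc a - nc b - nc (a * b) is twice the genus of (a, b). *)
Lemma split_defect a b u v : u != v -> u \in porbit a v ->
  nc a + nc b + nc (a * b) + (ncc (tperm u v * a) b).*2 <=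
  nc (tperm u v * a) + nc b + nc (tperm u v * a * b) + (ncc a b).*2.
Proof.
move=> nuv huv; have e1 := nc_tperm a nuv; rewrite huv /= in e1.
have e2 := nc_tperm (a * b) nuv; rewrite permMA in e2.
have cuv : conn a b u v by rewrite conn_sym; apply: conn_porbitl.
have sub := tperm_sub cuv.
have le1 : ncc (tperm u v * a) b <= (ncc a b).+1.
  apply: (ncc_leS (u := u) (v := v) sub) => x; first exact: tpermM_conn.
  exact/connr/conn_refl.
(* If u and v stay connected, no component appears, and the new cycle of [a] pays for at most one
   lost face. Otherwise one component appears, but u and v lie on different faces, so a face is
   gained as well. *)
have [h|h] := boolP (conn (tperm u v * a) b u v).
  have le2 : ncc (tperm u v * a) b <= ncc a b.
    apply: ncc_le; apply: conn_sub => x; last exact/connr/conn_refl.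
    case/or3P: (tpermM_conn a b u v x) => // /andP[k k'].
      by apply: conn_trans k'; apply: conn_trans h; rewrite conn_sym.
    by apply: conn_trans k'; rewrite conn_sym; apply: conn_trans h k.
  by move: e2; case: (u \in _) => /=; lia.
have e3 := nc_tperm (tperm u v * a * b) nuv.
rewrite -permMA tperm_mulK permMA in e3.
have n3 : u \notin porbit (tperm u v * a * b) v.
  by apply: contra h; rewrite porbit_sym; apply: conn_porbit.
by rewrite n3 /= in e3; lia.
Qed.

Lemma nc1 : nc 1 = #|D|.
Proof.
rewrite /nc card_imset // => x y /eqP; rewrite eq_porbit_mem => /porbitP[i ->].
by rewrite expg1n perm1.
Qed.

Lemma ncc1 b : ncc 1 b = nc b.
Proof.
congr #|pred_of_set _|; apply: eq_imset => x; apply/setP=> y.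
by rewrite inE conn1_porbit.
Qed.

(** Cutting the cycles of [a] one by one never raises the genus and ends at [a = 1], where the genus
    is 0. *)
Lemma genus_ge0 a b : nc a + nc b + nc (a * b) <= #|D| + (ncc a b).*2.
Proof.
have [n] := ubnP (#|D| - nc a); elim: n a => // n IH a len.
case: (pickP [pred x | a x != x]) => [x /= nax|fix_a].
  have hx : a x \in porbit a x by apply/porbit_step/porbit_id.
  have e1 := nc_tperm a nax; have := split_defect b nax hx.
  rewrite hx /= in e1.
  have le_nc p : nc p <= #|D| by apply: leq_imset_card.
  have le' := le_nc (tperm (a x) x * a).
  have lt_n : #|D| - nc (tperm (a x) x * a) < n by lia.
  have h1 := IH _ lt_n; move=> h2; rewrite -(leq_add2r (ncc (tperm (a x) x * a) b).*2).
  by apply: leq_trans h2 _; rewrite [leqRHS]addnAC leq_add2r.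
have -> : a = 1 by apply/permP=> x; rewrite perm1; apply/eqP/negbFE/fix_a.
by rewrite mul1g ncc1 nc1; lia.
Qed.

(** By [split_defect] the genus cannot go up, and by [genus_ge0] it cannot go below 0. *)
Lemma planar_splitl a b u v : u \in porbit a v ->
  planar_pair a b -> planar_pair (tperm u v * a) b.
Proof.
have [->|nuv] := eqVneq u v; first by rewrite tperm1 mul1g.
move=> huv /eqP pl; have := split_defect b nuv huv.
have := genus_ge0 (tperm u v * a) b; rewrite /planar_pair.
by move=> h1 h2; apply/eqP; lia.
Qed.

(** The lost cycle of [a] is made up for by a face that splits, or by the merger of two components,
    which counts double and also covers a lost face. *)
Lemma planar_joinl a b u v : u \notin porbit a v ->
  ~~ conn a b u v || (u \in porbit (a * b) v) ->
  planar_pair a b -> planar_pair (tperm u v * a) b.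
Proof.
move=> nuv h /eqP pl; have n_uv : u != v by apply: contraNneq nuv => ->; apply: porbit_id.
have huv := conn_tperm_join b nuv.
have e1 := nc_tperm a n_uv; rewrite nuv /= in e1.
have e2 := nc_tperm (a * b) n_uv; rewrite permMA in e2.
have sub x y : conn a b x y -> conn (tperm u v * a) b x y.
  apply: conn_sub => z; last exact/connr/conn_refl.
  case/or3P: (tpermM_conn a b u v z) => // /andP[k k'].
    by apply: conn_trans k'; apply: conn_trans huv; rewrite conn_sym.
  by apply: conn_trans k'; rewrite conn_sym; apply: conn_trans huv k.
have := genus_ge0 (tperm u v * a) b; rewrite /planar_pair => h1.
case: (boolP (u \in _)) h e2 => [_ _ e2|_].
  by apply/eqP; have := ncc_le sub; rewrite /= in e2; lia.
rewrite orbF => nc_uv e2; apply/eqP; rewrite /= in e2.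
by have := ncc_lt sub huv nc_uv; lia.
Qed.

(** Inversion exchanges the two permutations, so statements on left factors transfer to right
    factors. *)
Lemma planar_inv a b : planar_pair b^-1 a^-1 = planar_pair a b.
Proof.
have e : b^-1 * a^-1 = (a * b)^-1 by rewrite invMg.
rewrite /planar_pair {}e /nc !porbitsV; congr (_ + _ == _); first exact: addnC.
congr (_ + _.*2); congr #|pred_of_set _|; apply: eq_imset => x.
by apply/setP=> y; rewrite !inE connV connC.
Qed.

Lemma planar_splitr a b u v : u \in porbit b v ->
  planar_pair a b -> planar_pair a (b * tperm u v).
Proof.
rewrite -(planar_inv a b) -(planar_inv a (b * _)) invMg tpermV -porbitV.
exact: planar_splitl.
Qed.

Lemma planar_joinr a b u v : u \notin porbit b v ->
  ~~ conn a b u v || (u \in porbit (a * b) v) ->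
  planar_pair a b -> planar_pair a (b * tperm u v).
Proof.
rewrite -(planar_inv a b) -(planar_inv a (b * _)) invMg tpermV -porbitV.
rewrite -(porbitV (a * b)) invMg -connV connC; exact: planar_joinl.
Qed.

(** A combinatorial Jordan curve property: if u and v stayed connected while lying on different
    faces, the cycle and the face gained by the cut would violate Euler's formula. *)
Lemma planar_split_face a b u v : u != v -> u \in porbit a v ->
  planar_pair a b ->
  conn (tperm u v * a) b u v = (u \in porbit (tperm u v * a * b) v).
Proof.
move=> nuv huv pl; apply/idP/idP => [h|]; last first.
  by rewrite porbit_sym; apply: conn_porbit.
have /eqP pl' := planar_splitl huv pl; move/eqP: pl => pl.
have e1 := nc_tperm a nuv; rewrite huv /= in e1.
have cuv : conn a b u v by rewrite conn_sym; apply: conn_porbitl.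
have le2 : ncc (tperm u v * a) b <= ncc a b.
  apply: ncc_le; apply: conn_sub => x; last exact/connr/conn_refl.
  case/or3P: (tpermM_conn a b u v x) => // /andP[k k'].
    by apply: conn_trans k'; apply: conn_trans h; rewrite conn_sym.
  by apply: conn_trans k'; rewrite conn_sym; apply: conn_trans h k.
have e3 := nc_tperm (tperm u v * a * b) nuv.
rewrite -permMA tperm_mulK permMA in e3.
by move: e3; case: (u \in _) => //=; lia.
Qed.

End Planarity.

(** * Deleting a dart *)

Section Skip.
Variable D : finType.
Implicit Types (a b p q : {perm D}) (x y z r s u v : D).

(** The predecessor of r is sent to its successor, and r becomes a fixed point. The set of darts
    does not change, and the results on transpositions apply. *)
Definition skip r p : {perm D} := p * tperm r (p r).

Lemma skipE r p y :
  skip r p y = if y == r then r else if p y == r then p r else p y.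
Proof.
rewrite permM; case: eqP => [->|/eqP ny]; first by rewrite tpermR.
case: tpermP => [->|/perm_inj e|]; rewrite ?eqxx //; first by rewrite e eqxx in ny.
by move/eqP/negPf=> ->.
Qed.

Lemma skip_id r p : skip r p r = r. Proof. by rewrite skipE eqxx. Qed.

Lemma conn_skip r a b y z : conn (skip r a) (skip r b) y z -> conn a b y z.
Proof.
have H p q w : conn p q w (skip r p w).
  rewrite skipE; case: ifP => [/eqP->|_]; first exact: conn_refl.
  by case: ifP => [/eqP<-|_]; rewrite !connlE conn_refl.
apply: conn_sub => w; first exact: H.
by rewrite connC; apply: H.
Qed.

Lemma conn_skipr r a b y z : conn a (skip r b) y z -> conn a b y z.
Proof.
apply: conn_sub => w; first exact/connl/conn_refl.
rewrite skipE; case: ifP => [/eqP->|_]; first exact: conn_refl.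
by case: ifP => [/eqP<-|_]; rewrite !connrE conn_refl.
Qed.

(** As [a] fixes s, a path crosses s only along [b]; whenever it stands at s, the shortened path
    stands at [b s] instead. *)
Lemma skip_conn s a b x z : a s = s -> x != s -> conn a b x z ->
  conn a (skip s b) x (if z == s then b s else z).
Proof.
move=> as_s nxs.
apply: (conn_ind (P := fun z => conn a (skip s b) x (if z == s then b s else z)))
  => [|y|y] /=.
- by rewrite (negPf nxs) conn_refl.
- case: eqP => [->|/eqP ny]; first by rewrite as_s eqxx.
  have -> : (a y == s) = false by rewrite -[X in _ == X]as_s (inj_eq perm_inj) (negPf ny).
  exact: connl.
- case: eqP => [->|/eqP ny]; first by case: ifP => // /eqP->.
  move/connr; rewrite skipE (negPf ny).
  by case: ifP.
Qed.

Lemma isolated a b r y : a r = r -> b r = r -> conn a b y r -> y = r.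
Proof.
move=> ar br; rewrite conn_sym => h; apply/eqP.
by apply: (conn_ind (P := pred1 r)) h => /= [|z /eqP->|z /eqP->]; rewrite ?ar ?br.
Qed.

(** Cycles are the components of the pair (1, p), so [skip_conn] applies with [a = 1]. *)
Lemma porbit_skip r p y : y != r -> porbit (skip r p) y = porbit p y :\ r.
Proof.
move=> ny; apply/setP=> z; rewrite !inE -!conn1_porbit.
apply/idP/andP => [h|[nz h]].
  split; last exact: conn_skipr h.
  apply: contra ny => /eqP e; rewrite e in h; apply/eqP.
  by apply: isolated h; rewrite ?perm1 ?skip_id.
by have := skip_conn (perm1 r) ny h; rewrite (negPf nz).
Qed.

Lemma skip_mul r a b : a r = r -> skip r (a * b) = a * skip r b.
Proof. by move=> ar; rewrite /skip permM ar permMA. Qed.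

Lemma skip_involutive r a : involutive a -> skip r a = tperm r (a r) * a.
Proof.
move=> aK; apply/permP=> y; rewrite !permM.
case: (tpermP r (a r) y) => [->|->|nr ns]; rewrite ?aK ?tpermL ?tpermR //.
by rewrite tpermD // eq_sym; [apply: contra_notN ns => /eqP<-; rewrite aK
  |apply: contra_notN nr => /eqP/perm_inj->].
Qed.

Lemma planar_skipr r a b : planar_pair a b -> planar_pair a (skip r b).
Proof. by apply: planar_splitr; rewrite porbit_sym; apply/porbit_step/porbit_id. Qed.

Lemma planar_skipl r a b : involutive a ->
  planar_pair a b -> planar_pair (skip r a) b.
Proof.
move=> aK; rewrite skip_involutive //.
by apply: planar_splitl; rewrite porbit_sym; apply/porbit_step/porbit_id.
Qed.

Lemma porbit_tperm_flip u v p : u != v ->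
  (u \in porbit (tperm u v * p) v) = (u \notin porbit p v).
Proof.
move=> nuv; have := nc_tperm p nuv; have := nc_tperm (tperm u v * p) nuv.
by rewrite tperm_mulK; do 2!case: (u \in _) => /=; lia.
Qed.

Lemma card_porbit_join x s p : x \notin porbit p s ->
  #|porbit (tperm x s * p) x| = #|porbit p x| + #|porbit p s|.
Proof.
move=> nxs; have n_xs : x != s by apply: contraNneq nxs => ->; apply: porbit_id.
have hs : s \in porbit (tperm x s * p) x by rewrite porbit_sym porbit_tperm_flip.
suff -> : porbit (tperm x s * p) x = porbit p x :|: porbit p s.
  rewrite cardsU; suff -> : porbit p x :&: porbit p s = set0 by rewrite cards0 subn0.
  apply/setP=> y; rewrite !inE; apply/negbTE; apply: contra nxs => /andP[h1 h2].
  by rewrite -eq_porbit_mem; move: h1 h2; rewrite -!eq_porbit_mem => /eqP<-.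
have closed z : z \in porbit (tperm x s * p) x -> p z \in porbit (tperm x s * p) x.
  move=> hz; have -> : p z = (tperm x s * p) (tperm x s z) by rewrite permM tpermK.
  by apply: porbit_step; case: tpermP => // _; apply: porbit_id.
apply/eqP; rewrite eqEsubset; apply/andP; split; apply/subsetP=> y.
  apply: (porbit_ind (P := mem (porbit p x :|: porbit p s))) => [|z] /=.
    by rewrite inE porbit_id.
  rewrite permM !inE; case: tpermP => [->|->|_ _] h.
  - by apply/orP; right; apply/porbit_step/porbit_id.
  - by apply/orP; left; apply/porbit_step/porbit_id.
  - by apply/orP; case/orP: h => /porbit_step; [left|right].
rewrite inE => /orP[]; apply: (porbit_ind (P := mem (porbit (tperm x s * p) x))) => //=.
exact: porbit_id.
Qed.

Lemma permXS p n x : (p ^+ n.+1) x = p ((p ^+ n) x).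
Proof. by rewrite !permX. Qed.

Lemma porbit_min p x n : 0 < n -> n < #|porbit p x| -> (p ^+ n) x != x.
Proof.
move=> n0 lt_n; have := uniq_traject_porbit p x; apply: contraTneq => e.
case: #|_| lt_n => // m lt_n; rewrite looping_uniq negbK.
apply/trajectP; exists (m - n); first lia.
by rewrite permX in e; rewrite -{1}(@subnK n m) // iterD e.
Qed.

Lemma card_porbit_min p x n : 0 < n -> (p ^+ n) x = x ->
  (forall m, 0 < m -> m < n -> (p ^+ m) x != x) -> #|porbit p x| = n.
Proof.
move=> n0 pn minn; apply/eqP; rewrite eqn_leq.
have c0 : 0 < #|porbit p x| by rewrite lt0n card_porbit_neq0.
apply/andP; split; rewrite leqNgt; apply/negP=> lt.
  by have := porbit_min n0 lt; rewrite pn eqxx.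
by have := minn _ c0 lt; rewrite permX iter_porbit eqxx.
Qed.

(* Cutting the cycle of [p] through [x] and [s]: the piece containing [x]
   runs from [p s] to [x], and its length is the distance from [s] to [x]. *)
Lemma porbit_dist p x s : x != s -> x \in porbit p s ->
  (skip s p ^+ #|porbit (tperm x s * p) x|.-1) (p s) = x.
Proof.
move=> nxs hx; set t := tperm x s * p; set k := #|_|.
have k0 : 0 < k by rewrite lt0n card_porbit_neq0.
have ns : s \notin porbit t x by rewrite porbit_sym porbit_tperm_flip ?hx.
have tx : t x = p s by rewrite permM tpermL.
have tX n : n < k -> (skip s p ^+ n) (p s) = (t ^+ n.+1) x.
  elim: n => [|n IH] lt_n; first by rewrite expg1 expg0 perm1.
  rewrite permXS IH ?(permXS t n.+1); last lia.
  set y := (t ^+ n.+1) x.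
  have nyx : y != x by apply: porbit_min.
  have hy : y \in porbit t x by apply: mem_porbit.
  have nys : y != s by apply: contraNneq ns => <-.
  have ty : t y = p y by rewrite permM tpermD // eq_sym.
  rewrite skipE (negPf nys) -ty; case: eqP => // e.
  by have := porbit_step hy; rewrite e (negPf ns).
by rewrite tX ?prednK // permX iter_porbit.
Qed.

(** Converse of [porbit_dist]: the bound on k ensures that x is reached for the first time after k -
    1 steps. *)
Lemma porbit_dist_card p x s k : x != s -> p s != s -> 0 < k ->
  k <= #|porbit (skip s p) x| -> (skip s p ^+ k.-1) (p s) = x ->
  #|porbit (tperm x s * p) x| = k.
Proof.
move=> nxs nps k0 lek e; set t := tperm x s * p; set q := skip s p in lek e.
have tx : t x = p s by rewrite permM tpermL.
have hq n : (q ^+ n) (p s) \in porbit q x.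
  by rewrite -e porbit_perm mem_porbit.
have ns y : y \in porbit q x -> y != s.
  by apply: contraTneq => ->; rewrite porbit_skip // !inE eqxx.
have nx n : n < k.-1 -> (q ^+ n) (p s) != x.
  move=> lt_n; apply/negP=> /eqP e'.
  have lt1 : 0 < k.-1 - n by lia.
  have lt2 : k.-1 - n < #|porbit q x| by lia.
  have := porbit_min lt1 lt2; rewrite -{1}e' -permM -expgD.
  by rewrite subnKC ?e ?eqxx //; lia.
have tX n : n < k -> (t ^+ n.+1) x = (q ^+ n) (p s).
  elim: n => [|n IH] lt_n; first by rewrite expg1 expg0 perm1.
  rewrite permXS IH ?(permXS q n); last lia.
  set y := (q ^+ n) (p s).
  have nyx : y != x by apply: nx; lia.
  have nys : y != s by apply/ns/hq.
  rewrite permM tpermD 1?eq_sym // /q skipE (negPf nys).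
  (* If [p y] were s, then [q] would return to [p s] in fewer steps than the length of its cycle. *)
  case: eqP => // e2; have := @porbit_min q (p s) n.+1 isT.
  have -> : porbit q (p s) = porbit q x by rewrite -[in RHS]e porbit_perm.
  rewrite permXS -/y {2}/q skipE (negPf nys) e2 !eqxx.
  by move=> H; have/H : n.+1 < #|porbit (skip s p) x| by [lia].
apply: card_porbit_min => // [|m m0 lt_m].
  by rewrite -(prednK k0) tX ?e //; lia.
by rewrite -(prednK m0) tX ?nx; lia.
Qed.

End Skip.

(** * Maps represented by a tree *)

(* A rooted map is encoded by its edge involution [a], its clockwise rotation
   [b] and a root leg [x], the only fixed point of [a] in its component; the
   faces are the cycles of [a * b], and only the component of [x] matters.
   Cutting the root edge {b x, a (b x)} turns [a (b x)] into a second leg. *)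
Fixpoint represents (T : tree) (D : finType) (a b : {perm D}) (x : D) : Prop :=
  let r := b x in let s := a r in
  let a1 := skip r a in let b1 := skip r b in
  match T with
  | Leaf => r = x
  | Isthmus T1 T2 =>
      [/\ r != x, ~~ conn a1 b1 x s, represents T1 a1 b1 x & represents T2 a1 b1 s]
  | Loop T k =>
      [/\ r != x, conn a1 b1 x s, represents T a1 (skip s b1) x
        & #|porbit (a * b) x| = k.+1]
  end.

Definition legged (D : finType) (a b : {perm D}) (x : D) :=
  [/\ involutive a, planar_pair a b & forall y, conn a b x y -> (a y == y) = (y == x)].

(** Conditions are imposed on [P] only, which is usually one component; surjectivity onto the
    component of the image is derived in [iso_conn_surj]. *)
Definition iso_on (D D' : finType) (P : pred D) (a b : {perm D}) (a' b' : {perm D'})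
    (f : D -> D') :=
  [/\ forall y z, P y -> P z -> f y = f z -> y = z,
      forall y, P y -> f (a y) = a' (f y) & forall y, P y -> f (b y) = b' (f y)].

Section Iso.
Variables (D D' : finType) (f : D -> D').
Implicit Types (P Q : pred D) (x y z r : D).

Lemma iso_on_sub P Q (a b : {perm D}) (a' b' : {perm D'}) : (forall y, Q y -> P y) ->
  iso_on P a b a' b' f -> iso_on Q a b a' b' f.
Proof.
move=> QP [fI fa fb]; split=> [y z /QP Py /QP Pz|y /QP|y /QP]; auto.
Qed.

Lemma iso_on_eq P (a b : {perm D}) (a' b' : {perm D'}) y z : iso_on P a b a' b' f -> P y -> P z ->
  (f y == f z) = (y == z).
Proof. by case=> fI _ _ Py Pz; apply/eqP/eqP => [/fI|->] //; apply. Qed.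

Lemma iso_on_skipr P (a b : {perm D}) (a' b' : {perm D'}) r : (forall y, P y -> P (b y)) -> P r ->
  iso_on P a b a' b' f -> iso_on P a (skip r b) a' (skip (f r) b') f.
Proof.
move=> Pb Pr I; have [fI fa fb] := I; split=> // y Py.
rewrite !skipE -fb // !(iso_on_eq I) //; last exact: Pb.
by do 2!case: ifP => // _; rewrite fb.
Qed.

Lemma iso_on_skipl P (a b : {perm D}) (a' b' : {perm D'}) r : (forall y, P y -> P (a y)) -> P r ->
  iso_on P a b a' b' f -> iso_on P (skip r a) b (skip (f r) a') b' f.
Proof.
move=> Pb Pr I; have [fI fa fb] := I; split=> // y Py.
rewrite !skipE -fa // !(iso_on_eq I) //; last exact: Pb.
by do 2!case: ifP => // _; rewrite fa.
Qed.

Variables (a b : {perm D}) (a' b' : {perm D'}) (x : D).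
Hypothesis I : iso_on (conn a b x) a b a' b' f.

Lemma iso_conn y z : conn a b x y -> conn a b y z -> conn a' b' (f y) (f z).
Proof.
have [fI fa fb] := I; move=> hy h.
suff /andP[] : conn a b x z && conn a' b' (f y) (f z) by [].
apply: (conn_ind (P := fun z => conn a b x z && conn a' b' (f y) (f z))) h => [|u|u].
- by rewrite hy conn_refl.
- by case/andP=> h1 h2; rewrite connl //= fa // connl.
- by case/andP=> h1 h2; rewrite connr //= fb // connr.
Qed.

Lemma iso_conn_surj y (z' : D') : conn a b x y -> conn a' b' (f y) z' ->
  exists2 z, conn a b y z & z' = f z.
Proof.
have [fI fa fb] := I; move=> hy h.
suff /existsP[z /andP[h1 /eqP h2]] : [exists z, conn a b y z && (z' == f z)] by exists z.
apply: (conn_ind (P := fun z' : D' => [exists z, conn a b y z && (z' == f z)])) h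
  => [|u|u].
- by apply/existsP; exists y; rewrite conn_refl eqxx.
- case/existsP=> z /andP[h1 /eqP->]; apply/existsP; exists (a z).
  by rewrite connl //= fa // (conn_trans hy h1).
- case/existsP=> z /andP[h1 /eqP->]; apply/existsP; exists (b z).
  by rewrite connr //= fb // (conn_trans hy h1).
Qed.

Lemma iso_face_iter y n : conn a b x y ->
  conn a b x (((a * b) ^+ n) y) /\ f (((a * b) ^+ n) y) = ((a' * b') ^+ n) (f y).
Proof.
have [fI fa fb] := I; move=> hy; elim: n => [|n [IH1 IH2]].
  by rewrite !expg0 !perm1.
rewrite !permXS -IH2 !permM; split; first exact/connr/connl.
by rewrite fb ?fa //; apply: connl.
Qed.

Lemma iso_card_face : #|porbit (a' * b') (f x)| = #|porbit (a * b) x|.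
Proof.
have [fI fa fb] := I.
have -> : porbit (a' * b') (f x) = f @: porbit (a * b) x.
  apply/setP=> z; apply/porbitP/imsetP => [[n ->]|[y /porbitP[n ->] ->]].
    exists (((a * b) ^+ n) x); rewrite ?mem_porbit //.
    by have [_ ->] := iso_face_iter n (conn_refl a b x).
  by exists n; have [_ ->] := iso_face_iter n (conn_refl a b x).
by apply: card_in_imset => y z hy hz; apply: fI; apply: conn_porbit.
Qed.

End Iso.

Lemma represents_iso T (D D' : finType) (a b : {perm D}) (a' b' : {perm D'}) x f :
  iso_on (conn a b x) a b a' b' f -> represents T a b x -> represents T a' b' (f x).
Proof.
elim: T D D' a b a' b' x f => [|T1 IH1 T2 IH2|T IH k] D D' a b a' b' x f I /=;
  have [fI fa fb] := I; have c0 := conn_refl a b x.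
- by move=> e; rewrite -fb // e.
- case=> nr nc R1 R2; rewrite -fb //.
  have cr := connr c0; have cs := connl cr; rewrite -fa //.
  rewrite (iso_on_eq I) //.
  have I1 : iso_on (conn a b x) (skip (b x) a) (skip (b x) b)
      (skip (f (b x)) a') (skip (f (b x)) b') f.
    apply: iso_on_skipr (iso_on_skipl _ _ I) => // y hy; [exact: connr|exact: connl].
  have Ix := iso_on_sub (fun y => @conn_skip _ (b x) a b x y) I1.
  split=> //.
  + apply: contra nc => h.
    have [z hz e] := iso_conn_surj Ix (conn_refl _ _ _) h.
    by have -> : a (b x) = z by apply: fI => //; apply: conn_skip hz.
  + exact: IH1 Ix R1.
  + by apply: IH2 R2; apply: iso_on_sub I1 => y /conn_skip; apply: conn_trans.
- case=> nr nc R dk; rewrite -fb //.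
  have cr := connr c0; have cs := connl cr; rewrite -fa //.
  rewrite (iso_on_eq I) //.
  have I1 : iso_on (conn a b x) (skip (b x) a) (skip (b x) b)
      (skip (f (b x)) a') (skip (f (b x)) b') f.
    apply: iso_on_skipr (iso_on_skipl _ _ I) => // y hy; [exact: connr|exact: connl].
  have Ix := iso_on_sub (fun y => @conn_skip _ (b x) a b x y) I1.
  split=> //; last by rewrite (iso_card_face I).
    exact: (iso_conn Ix (conn_refl _ _ _) nc).
  apply: IH R; apply: iso_on_sub (iso_on_skipr _ nc Ix) => y; last exact: connr.
  exact: conn_skipr.
Qed.

(** The three cases exclude each other, and in the loop case k is determined by the length of the
    face. *)
Lemma represents_inj T T' (D : finType) (a b : {perm D}) x :
  represents T a b x -> represents T' a b x -> T = T'.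
Proof.
elim: T T' D a b x => [|T1 IH1 T2 IH2|T IH k] [|T1' T2'|T' k'] D a b x //=.
- by move=> -> [/eqP].
- by move=> -> [/eqP].
- by case=> /eqP h _ _ _ /h.
- by case=> _ _ R1 R2 [_ _ R1' R2']; rewrite (IH1 _ _ _ _ _ R1 R1') (IH2 _ _ _ _ _ R2 R2').
- by case=> _ /negP h _ _ [_ /h].
- by case=> /eqP h _ _ _ /h.
- by case=> _ h _ _ [_ /negP].
- by case=> _ _ R1 e [_ _ R1']; rewrite (IH _ _ _ _ _ R1 R1') e => -[->].
Qed.

(** * Deleting the root edge: components, planarity and faces of what remains *)

Section RootEdge.
Variables (D : finType) (a b : {perm D}) (x : D).
Hypotheses (G : legged a b x) (nbx : b x != x).
Let r := b x.
Let s := a r.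
Let a1 := skip r a.
Let b1 := skip r b.
Let psi := a1 * b1.

Lemma root_fix : a x = x.
Proof. by case: G => _ _ /(_ x (conn_refl _ _ _)); rewrite eqxx => /eqP. Qed.

Lemma root_as : a s = r. Proof. by case: G => aK _ _; apply: aK. Qed.

Lemma root_sr : s != r.
Proof.
case: G => _ _ /(_ r); rewrite connr ?conn_refl // => /(_ isT).
by rewrite (negPf nbx) => /negbT.
Qed.

Lemma root_sx : s != x.
Proof.
apply: contraNneq nbx => e; rewrite -/r; apply/eqP.
by rewrite -root_as e root_fix.
Qed.

Lemma root_a1E y : a1 y = if y == r then r else if y == s then s else a y.
Proof.
rewrite skipE -/s; case: G => aK _ _.
by rewrite -[X in a y == X]root_as (inj_eq perm_inj).
Qed.

Lemma root_b1E y : b1 y = if y == r then r else if y == x then b r else b y.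
Proof. by rewrite skipE (inj_eq perm_inj). Qed.

Lemma root_a1r : a1 r = r. Proof. exact: skip_id. Qed.
Lemma root_b1r : b1 r = r. Proof. exact: skip_id. Qed.
Lemma root_a1s : a1 s = s. Proof. by rewrite root_a1E eqxx (negPf root_sr). Qed.
Lemma root_b1x : b1 x = b r. Proof. by rewrite root_b1E eqxx eq_sym (negPf nbx). Qed.

Lemma root_a1K : involutive a1.
Proof.
case: (G) => aK _ _ y; rewrite !root_a1E.
case: (eqVneq y r) => [->|nr]; first by rewrite eqxx.
case: (eqVneq y s) => [->|ns]; first by rewrite eqxx (negPf root_sr).
rewrite aK -[X in a y == X]root_as (inj_eq perm_inj) (negPf ns).
by rewrite {1}/s (inj_eq perm_inj) (negPf nr).
Qed.

Lemma root_conn y : conn a b x y = [|| y == r, conn a1 b1 x y | conn a1 b1 s y].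
Proof.
apply/idP/or3P => [h|[/eqP->|h|h]]; last 3 first.
- exact/connr/conn_refl.
- exact: conn_skip h.
- by apply: conn_trans (conn_skip h); apply/connl/connr/conn_refl.
apply/or3P; move: h.
apply: (conn_ind (P := fun y => [|| y == r, conn a1 b1 x y | conn a1 b1 s y]))
  => [|z|z].
- by rewrite conn_refl orbT.
- have [->|nr /=] := eqVneq z r; first by rewrite -/s conn_refl !orbT.
  have [->|ns] := eqVneq z s; first by rewrite root_as eqxx.
  rewrite -(connlE a1 b1 x z) -(connlE a1 b1 s z) root_a1E (negPf nr) (negPf ns).
  by move=> ->; rewrite orbT.
- have [->|nr /=] := eqVneq z r.
    by rewrite -root_b1x connrE conn_refl orbT.
  have [->|ns] := eqVneq z x; first by rewrite eqxx.
  rewrite -(connrE a1 b1 x z) -(connrE a1 b1 s z) root_b1E (negPf nr) (negPf ns).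
  by move=> ->; rewrite orbT.
Qed.

Lemma root_isolated y : y != r -> conn a1 b1 y r = false.
Proof. by move=> ny; apply: contraNF ny => /isolated->; rewrite ?skip_id. Qed.

Lemma root_planar : planar_pair a1 b1.
Proof. by case: G => aK pl _; apply/planar_skipr/planar_skipl. Qed.

(** Apart from r itself, the deletion only exchanges the face successors of the two legs x and s. *)
Lemma root_skip_face : skip r (a * b) = tperm x s * psi.
Proof.
have [aK _ _] := G; have sr := root_sr; have sx := root_sx.
have psiE z : psi z = b1 (a1 z) by exact: permM.
apply/permP=> y; rewrite skipE (permM (tperm x s)) psiE !(permM a b).
have bax z : (b (a z) == r) = (z == x).
  by rewrite (inj_eq perm_inj) -{1}root_fix (inj_eq perm_inj).
rewrite bax; case: tpermP => [->|->|/eqP nx /eqP ns].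
- rewrite eqxx eq_sym (negPf nbx) root_a1s root_b1E (negPf sr) (negPf sx).
  by [].
- rewrite (negPf sr) (negPf sx) root_as root_a1E eq_sym (negPf nbx).
  by rewrite eq_sym (negPf sx) root_fix root_b1x.
- have [->|nr] := eqVneq y r; first by rewrite root_a1r root_b1r.
  rewrite (negPf nx) root_a1E (negPf nr) (negPf ns) root_b1E.
  rewrite -{1}root_as (inj_eq perm_inj) (negPf ns).
  by rewrite -{1}root_fix (inj_eq perm_inj) (negPf nx).
Qed.

Lemma root_card_face : #|porbit (a * b) x| = #|porbit (tperm x s * psi) x|.+1.
Proof.
rewrite -root_skip_face porbit_skip 1?eq_sym //.
rewrite (cardsD1 r (porbit (a * b) x)); suff -> : r \in porbit (a * b) x by [].
by have := porbit_step (porbit_id (a * b) x); rewrite permM root_fix.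
Qed.

(** The step that needs planarity: the legs are in one component only if they share a face. *)
Lemma root_face_conn : conn a1 b1 x s = (x \in porbit psi s).
Proof.
have [aK pl _] := G; have sr := root_sr; have sx := root_sx.
apply/idP/idP => [/conn_skipr h|]; last by rewrite conn_sym => /conn_porbit; rewrite conn_sym.
have e1 : a1 = tperm r s * a by rewrite -skip_involutive.
(* The cut is first made in [a] alone, with r still attached to its vertex; on the faces of [a1 * b]
   the dart r directly follows x, so x can replace it once r is bypassed. *)
have h1 : conn a1 b r s by apply: conn_trans h; rewrite conn_sym; apply/connr/conn_refl.
rewrite e1 planar_split_face // in h1; last first.
- by rewrite porbit_sym; apply/porbit_step/porbit_id.
- by rewrite eq_sym.
rewrite -e1 in h1; rewrite /psi /b1 -skip_mul ?root_a1r // porbit_skip // !inE eq_sym nbx /=.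
have e : (a1 * b) x = r.
  by rewrite permM root_a1E eq_sym (negPf nbx) eq_sym (negPf sx) root_fix.
by rewrite -eq_porbit_mem -(porbit_perm _ 1 x) expg1 e eq_porbit_mem.
Qed.

Lemma root_isthmus : ~~ conn a1 b1 x s -> legged a1 b1 x /\ legged a1 b1 s.
Proof.
move=> nc; have [_ _ fix_a] := G.
split; split; try exact: root_a1K; try exact: root_planar; move=> y hy.
  have hy' := conn_skip hy; rewrite -fix_a // root_a1E.
  have [e|nr] := eqVneq y r; first by rewrite e root_isolated // eq_sym in hy.
  have [e|ns //] := eqVneq y s; by rewrite e (negPf nc) in hy.
rewrite root_a1E.
have [e|nr] := eqVneq y r; first by rewrite e root_isolated ?root_sr in hy.
have [e|ns //] := eqVneq y s; first by rewrite e eqxx.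
rewrite fix_a ?root_conn ?hy ?orbT //.
by apply: contraNF nc => /eqP<-; rewrite conn_sym.
Qed.

Lemma root_loop_conn y : conn a1 b1 x s ->
  conn a b x y = [|| y == r, y == s | conn a1 (skip s b1) x y].
Proof.
move=> h; rewrite root_conn; congr (_ || _).
apply/idP/idP => [h'|/orP[/eqP->|/conn_skipr->]]; rewrite ?h ?orbT //.
have h2 : conn a1 b1 x y by case/orP: h' => // h'; apply: conn_trans h h'.
have := skip_conn root_a1s _ h2; rewrite eq_sym root_sx => /(_ isT).
by case: eqP.
Qed.

Lemma root_loop_s y : y != s -> conn a1 (skip s b1) y s = false.
Proof. by move=> ny; apply: contraNF ny => /isolated->; rewrite ?skip_id ?root_a1s. Qed.

Lemma root_loop_r y : y != r -> conn a1 (skip s b1) y r = false.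
Proof.
by move=> ny; apply: contraFF (root_isolated ny) => /conn_skipr.
Qed.

Lemma root_loop : conn a1 b1 x s -> legged a1 (skip s b1) x.
Proof.
move=> h; have [_ _ fix_a] := G; split; first exact: root_a1K.
  exact: planar_skipr root_planar.
move=> y hy; have hy' : conn a b x y by rewrite root_loop_conn // hy !orbT.
rewrite -fix_a // root_a1E.
have [e|nr] := eqVneq y r; first by rewrite e root_loop_r // eq_sym in hy.
have [e|ns //] := eqVneq y s; by rewrite e root_loop_s // eq_sym root_sx in hy.
Qed.

Lemma root_loop_face : a1 * skip s b1 = skip s psi.
Proof. exact/esym/skip_mul/root_a1s. Qed.

Lemma root_psi_s : psi s = b1 s.
Proof. by rewrite [LHS](permM a1 b1) root_a1s. Qed.

Lemma root_b1s : conn a1 b1 x s -> b1 s != s.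
Proof.
move=> h; apply: contraTneq h => e.
by apply: contra root_sx => /isolated->; rewrite ?root_a1s.
Qed.

Lemma root_loop_b1s : conn a1 b1 x s -> conn a1 (skip s b1) x (b1 s).
Proof.
move=> h; have := skip_conn root_a1s _ h; rewrite eqxx eq_sym root_sx; exact.
Qed.

End RootEdge.

(** The root leg is the extra unit in both counts: it is one dart of the component and one dart of
    the outer face. *)
Lemma represents_counts T (D : finType) (a b : {perm D}) x :
  represents T a b x -> legged a b x ->
  [/\ tvalid T, #|ccls a b x| = (tedges T).*2.+1 & #|porbit (a * b) x| = (tdeg T).+1].
Proof.
elim: T D a b x => [|T1 IH1 T2 IH2|T IH k] D a b x /=.
- move=> bx G; have ax := root_fix G; split=> //.
    rewrite -(cards1 x); congr #|pred_of_set _|; apply/setP=> y; rewrite !inE.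
    apply/idP/eqP => [|->]; last exact: conn_refl.
    by rewrite conn_sym => /isolated->.
  apply: card_porbit_min => //; last by case.
  by rewrite expg1 permM ax bx.
- case=> nbx nc R1 R2 G; have [G1 G2] := root_isthmus G nbx nc.
  have [v1 e1 d1] := IH1 _ _ _ _ R1 G1; have [v2 e2 d2] := IH2 _ _ _ _ R2 G2.
  split; first by rewrite v1.
    set r := b x in nc R1 R2 e1 e2 *; set s := a r in nc R2 e2 *.
    set a1 := skip r a in nc R1 R2 e1 e2 *; set b1 := skip r b in nc R1 R2 e1 e2 *.
    have -> : ccls a b x = r |: (ccls a1 b1 x :|: ccls a1 b1 s).
      by apply/setP=> y; rewrite !inE root_conn.
    rewrite cardsU1 cardsU e1 e2.
    have -> : ccls a1 b1 x :&: ccls a1 b1 s = set0.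
      apply/setP=> y; rewrite !inE; apply/negbTE; apply: contra nc => /andP[h1 h2].
      by apply: conn_trans h1 _; rewrite conn_sym.
    rewrite !inE root_isolated 1?eq_sym // root_isolated ?root_sr //= cards0; lia.
  rewrite root_card_face // card_porbit_join ?d1 ?d2; last by rewrite -root_face_conn.
  by rewrite addSn addnS.
- case=> nbx h R dk G; have G1 := root_loop G nbx h.
  have [v e d] := IH _ _ _ _ R G1; have sx := root_sx G nbx.
  have hx : x \in porbit (skip (b x) a * skip (b x) b) (a (b x)).
    by rewrite -root_face_conn.
  have ek := dk; rewrite root_card_face // in ek; move: ek => [ek].
  split=> //.
    (* The piece of length k containing x is cut from the cycle of x and s without s, and that cycle
       minus s is the outer face of the smaller map. *)
    rewrite v /= -d -ek lt0n card_porbit_neq0 /=; apply: subset_leq_card.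
    rewrite root_loop_face // porbit_skip 1?eq_sym //; apply/subsetP=> y hy.
    rewrite !inE; apply/andP; split.
      apply: contraTneq hy => ->.
      by rewrite porbit_sym porbit_tperm_flip ?hx // eq_sym.
    move: y hy; apply: porbit_ind => [|y hy]; first exact: porbit_id.
    rewrite (permM (tperm _ _)); apply: porbit_step; case: tpermP => // _.
    - by rewrite porbit_sym.
    - exact: porbit_id.
  have -> : ccls a b x = b x |: (a (b x) |: ccls (skip (b x) a) (skip (a (b x)) (skip (b x) b)) x).
    by apply/setP=> y; rewrite !inE root_loop_conn.
  have nxr : x != b x by rewrite eq_sym.
  have nxs : x != a (b x) by rewrite eq_sym.
  have nrs : (b x == a (b x)) = false by rewrite eq_sym (negPf (root_sr G nbx)).
  by rewrite !cardsU1 !inE e root_loop_r // root_loop_s // nrs /=; lia.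
Qed.

(** Induction on the component of x: what is left after the deletion no longer contains [b x]. *)
Lemma represents_total (D : finType) (a b : {perm D}) x :
  legged a b x -> exists T, represents T a b x.
Proof.
have [n] := ubnP #|ccls a b x|; elim: n a b x => // n IH a b x len G.
have [bx|nbx] := eqVneq (b x) x; first by exists Leaf.
have lt (S : {set D}) : S \subset ccls a b x :\ b x -> #|S| < n.
  move=> /subset_leq_card h; rewrite -ltnS; apply: leq_trans len; rewrite ltnS.
  rewrite (cardsD1 (b x) (ccls a b x)) [b x \in _]inE connr ?conn_refl //.
have [h|nh] := boolP (conn (skip (b x) a) (skip (b x) b) x (a (b x))).
  have G1 := root_loop G nbx h.
  have [|T R] := IH _ _ _ _ G1.
    apply: lt; apply/subsetP=> y; rewrite !inE => hy; rewrite [conn a b x y]root_loop_conn //.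
    rewrite hy !orbT andbT; apply: contraTneq hy => ->.
    by rewrite root_loop_r // eq_sym.
  by exists (Loop T #|porbit (a * b) x|.-1); split=> //; rewrite prednK // lt0n card_porbit_neq0.
have [G1 G2] := root_isthmus G nbx nh.
have [|T1 R1] := IH _ _ _ _ G1.
  apply: lt; apply/subsetP=> y; rewrite !inE => hy; rewrite [conn a b x y]root_conn //.
  rewrite hy !orbT andbT; apply: contraTneq hy => ->.
  by rewrite root_isolated // eq_sym.
have [|T2 R2] := IH _ _ _ _ G2.
  apply: lt; apply/subsetP=> y; rewrite !inE => hy; rewrite [conn a b x y]root_conn //.
  rewrite hy !orbT andbT; apply: contraTneq hy => ->.
  by rewrite root_isolated // root_sr.
by exists (Isthmus T1 T2).
Qed.

(** * Extending isomorphisms across the root edge *)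

Section RootEdgeIso.
Variables (D D' : finType) (a b : {perm D}) (x : D) (a' b' : {perm D'}) (x' : D').
Hypotheses (G : legged a b x) (nbx : b x != x) (G' : legged a' b' x') (nbx' : b' x' != x').
Let r := b x.
Let s := a r.
Let a1 := skip r a.
Let b1 := skip r b.
Let r' := b' x'.
Let s' := a' r'.
Let a1' := skip r' a'.
Let b1' := skip r' b'.

(** Sending r to r' is the only possible extension, and it commutes because r is determined by its
    places next to x and opposite s. *)
Lemma root_glue_iso f : f x = x' -> f s = s' ->
  iso_on (fun y => conn a1 b1 x y || conn a1 b1 s y) a1 b1 a1' b1' f ->
  exists2 g, g x = x' & iso_on (conn a b x) a b a' b' g.
Proof.
move=> fx fs I; have [fI fa fb] := I.
have nxr : x != r by rewrite eq_sym.
have nsr : s != r := root_sr G nbx.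
have nxr' : x' != r' by rewrite eq_sym.
have nsr' : s' != r' := root_sr G' nbx'.
pose P y := conn a1 b1 x y || conn a1 b1 s y.
have Px : P x by rewrite /P conn_refl.
have Ps : P s by rewrite /P conn_refl orbT.
have PE y : conn a b x y -> y != r -> P y.
  by rewrite root_conn // => /predU1P[->|//]; rewrite eqxx.
have Ix : iso_on (conn a1 b1 x) a1 b1 a1' b1' f.
  by apply: iso_on_sub I => y; rewrite /P => ->.
have Is : iso_on (conn a1 b1 s) a1 b1 a1' b1' f.
  by apply: iso_on_sub I => y; rewrite /P => ->; rewrite orbT.
have fr y : P y -> f y != r'.
  case/orP=> h; apply/eqP=> e.
    by have := iso_conn Ix (conn_refl _ _ _) h; rewrite fx e root_isolated.
  by have := iso_conn Is (conn_refl _ _ _) h; rewrite fs e root_isolated.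
exists (fun y => if y == r then r' else f y); first by rewrite (negPf nxr).
split=> [y z hy hz|y hy|y hy].
- have [->|ny] := eqVneq y r; have [->|nz] := eqVneq z r => // e.
  + by have := fr _ (PE _ hz nz); rewrite -e eqxx.
  + by have := fr _ (PE _ hy ny); rewrite e eqxx.
  + exact: fI (PE _ hy ny) (PE _ hz nz) e.
- have [->|ny] := eqVneq y r; first by rewrite (negPf nsr).
  have [->|nys] := eqVneq y s; first by rewrite root_as // eqxx fs root_as.
  have Py := PE _ hy ny.
  have ea : a1 y = a y by rewrite root_a1E // -/r -/s (negPf ny) (negPf nys).
  have -> : (a y == r) = false.
    by rewrite -ea; apply: contraNF ny => /eqP e; rewrite -(root_a1K G nbx y) -/a1 -/r e root_a1r.
  rewrite -ea fa // root_a1E // -/r' -/s' (negPf (fr _ Py)).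
  by rewrite -fs (iso_on_eq I) // (negPf nys).
- have [->|ny] := eqVneq y r.
    have e1 := root_b1x nbx; have e1' := root_b1x nbx'.
    rewrite -/r -/r' in e1 e1'; rewrite -e1 -e1'.
    have -> : (b1 x == r) = false.
      by apply: contraNF nxr => /eqP e; apply/eqP/(@perm_inj _ b1); rewrite -/b1 e root_b1r.
    by rewrite -/b1 fb // fx.
  have [->|nyx] := eqVneq y x; first by rewrite eqxx fx.
  have Py := PE _ hy ny.
  have eb : b1 y = b y by rewrite root_b1E // -/r (negPf ny) (negPf nyx).
  have -> : (b y == r) = false by rewrite (inj_eq perm_inj) (negPf nyx).
  rewrite -eb fb // root_b1E // -/r' (negPf (fr _ Py)).
  by rewrite -fx (iso_on_eq I) // (negPf nyx).
Qed.

Lemma root_isthmus_iso f1 f2 : ~~ conn a1 b1 x s -> ~~ conn a1' b1' x' s' ->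
  f1 x = x' -> f2 s = s' ->
  iso_on (conn a1 b1 x) a1 b1 a1' b1' f1 -> iso_on (conn a1 b1 s) a1 b1 a1' b1' f2 ->
  exists2 g, g x = x' & iso_on (conn a b x) a b a' b' g.
Proof.
move=> nc nc' f1x f2s I1 I2.
have ncs y : conn a1 b1 s y -> conn a1 b1 x y = false.
  by move=> h; apply: contraNF nc => h'; apply: conn_trans h' _; rewrite conn_sym.
have c1 y : conn a1 b1 x y -> conn a1' b1' x' (f1 y).
  by move=> h; rewrite -f1x; exact: (iso_conn I1 (conn_refl _ _ _) h).
have c2 y : conn a1 b1 s y -> conn a1' b1' s' (f2 y).
  by move=> h; rewrite -f2s; exact: (iso_conn I2 (conn_refl _ _ _) h).
(* The images stay apart because the second root edge is an isthmus too. *)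
have n12 y z : conn a1 b1 x y -> conn a1 b1 s z -> f1 y <> f2 z.
  move=> /c1 h1 /c2 h2 e; case/negP: nc'; apply: conn_trans h1 _.
  by rewrite e conn_sym.
have [fI fa fb] := I1; have [gI ga gb] := I2.
apply: (root_glue_iso (f := fun y => if conn a1 b1 x y then f1 y else f2 y)).
- by rewrite conn_refl.
- by rewrite ncs ?conn_refl.
split=> [y z|y|y].
- case: ifP => [hy _|_ /= hy]; case: ifP => [hz _|_ /= hz].
  + exact: fI.
  + by move/n12; case.
  + by move/esym/n12; case.
  + exact: gI.
- by rewrite connlE; case: ifP => [hy _|_ /= hy]; [apply: fa|apply: ga].
- by rewrite connrE; case: ifP => [hy _|_ /= hy]; [apply: fb|apply: gb].
Qed.

Lemma root_loop_iso f : conn a1 b1 x s -> conn a1' b1' x' s' ->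
  f x = x' -> iso_on (conn a1 (skip s b1) x) a1 (skip s b1) a1' (skip s' b1') f ->
  #|porbit (a * b) x| = #|porbit (a' * b') x'| ->
  exists2 g, g x = x' & iso_on (conn a b x) a b a' b' g.
Proof.
move=> h h' fx I dk; have [fI fa fb] := I.
have nsx : s != x := root_sx G nbx; have nxs : x != s by rewrite eq_sym.
have nsx' : s' != x' := root_sx G' nbx'; have nxs' : x' != s' by rewrite eq_sym.
have a1s : a1 s = s := root_a1s G nbx.
have a1s' : a1' s' = s' := root_a1s G' nbx'.
pose y0 := b1 s; pose y0' := b1' s'.
have hy0 : conn a1 (skip s b1) x y0 := root_loop_b1s G nbx h.
(* [b1 s] is located by its distance to the root on the outer face. *)
have fy0 : f y0 = y0'.
  have hx : x \in porbit (a1 * b1) s by rewrite -root_face_conn.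
  have hx' : x' \in porbit (a1' * b1') s' by rewrite -root_face_conn.
  move: dk; rewrite (root_card_face G nbx) (root_card_face G' nbx') => -[dk].
  have e := porbit_dist nxs hx; have e' := porbit_dist nxs' hx'.
  rewrite -[skip _ _](root_loop_face G nbx) [(a1 * b1) s](root_psi_s G nbx) in e.
  rewrite -[skip _ _](root_loop_face G' nbx') [(a1' * b1') s'](root_psi_s G' nbx') in e'.
  have [_] := iso_face_iter I (#|porbit (tperm x s * (a1 * b1)) x|.-1) hy0.
  rewrite [X in f X = _]e fx -[in LHS]e' dk => /perm_inj.
  exact: esym.
have fs y : conn a1 (skip s b1) x y -> f y != s'.
  move=> hy; apply/eqP=> e.
  by have := iso_conn I (conn_refl _ _ _) hy; rewrite fx e root_loop_s.
have PE y : conn a1 b1 x y -> y != s -> conn a1 (skip s b1) x y.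
  by move=> hy ny; have := skip_conn a1s nxs hy; rewrite (negPf ny).
apply: (root_glue_iso (f := fun y => if y == s then s' else f y)).
- by rewrite (negPf nxs).
- by rewrite eqxx.
apply: (@iso_on_sub _ _ _ (conn a1 b1 x)) => [y /orP[//|]|]; first exact: conn_trans h.
split=> [y z hy hz|y hy|y hy].
- have [->|ny] := eqVneq y s; have [->|nz] := eqVneq z s => // e.
  + by have := fs _ (PE _ hz nz); rewrite -e eqxx.
  + by have := fs _ (PE _ hy ny); rewrite e eqxx.
  + exact: fI (PE _ hy ny) (PE _ hz nz) e.
- have [->|ny] := eqVneq y s; first by rewrite a1s eqxx a1s'.
  rewrite -[X in _ == X]a1s (inj_eq perm_inj) (negPf ny); exact/fa/PE.
- have [->|ny] := eqVneq y s; first by rewrite (negPf (root_b1s G nbx h)).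
  have hy2 := PE _ hy ny; have := fb _ hy2; rewrite (skipE s b1) (skipE s' b1') (negPf ny) (negPf (fs _ hy2)).
  (* The bypass of s is used on both sides or on neither: a mixed case would give [y0] or [y0'] a
     second preimage besides s or s'. *)
  have [e|ne] := eqVneq (b1 y) s; have [e'|ne'] := eqVneq (b1' (f y)) s'.
  + by rewrite e'.
  + by rewrite -/y0 fy0 => /perm_inj e2; have := fs _ hy2; rewrite -e2 eqxx.
  + rewrite -/y0' -fy0 => /fI e2; have/perm_inj e3 : b1 y = b1 s.
      by apply: e2 => //; apply: PE ne; apply: connr.
    by rewrite e3 eqxx in ny.
  + by [].
Qed.

End RootEdgeIso.

Lemma represents_unique T (D D' : finType) (a b : {perm D}) x (a' b' : {perm D'}) x' :
  legged a b x -> legged a' b' x' -> represents T a b x -> represents T a' b' x' ->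
  exists2 f, f x = x' & iso_on (conn a b x) a b a' b' f.
Proof.
elim: T a b x a' b' x' => [|T1 IH1 T2 IH2|T IH k] a b x a' b' x' G G' /=.
- move=> bx bx'; exists (fun=> x') => //.
  have cE y : conn a b x y -> y = x.
    by rewrite conn_sym => /isolated->; rewrite ?bx ?(root_fix G).
  by split=> [y z /cE-> /cE->|_ _|_ _] //; rewrite ?bx' ?(root_fix G').
- case=> n1 n2 R1 R2 [n1' n2' R1' R2'].
  have [G1 G2] := root_isthmus G n1 n2; have [G1' G2'] := root_isthmus G' n1' n2'.
  have [f1 f1x I1] := IH1 _ _ _ _ _ _ G1 G1' R1 R1'.
  have [f2 f2x I2] := IH2 _ _ _ _ _ _ G2 G2' R2 R2'.
  exact: root_isthmus_iso f1x f2x I1 I2.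
- case=> n1 n2 R dk [n1' n2' R' dk'].
  have G1 := root_loop G n1 n2; have G1' := root_loop G' n1' n2'.
  have [f fx I] := IH _ _ _ _ _ _ G1 G1' R R'.
  by apply: root_loop_iso fx I _; rewrite ?dk ?dk'.
Qed.

(** * Construction of a map with a prescribed tree *)

Lemma subset_with_card (D : finType) (A : {set D}) x n :
  x \in A -> n < #|A| -> exists B : {set D}, [/\ B \subset A, x \in B & #|B| = n.+1].
Proof.
move=> xA; elim: n => [|n IH] lt_n.
  by exists [set x]; rewrite sub1set xA set11 cards1.
have [|B [sBA xB cB]] := IH; first exact: ltnW.
have /set0Pn[y] : A :\: B != set0.
  by rewrite -card_gt0 cardsD (setIidPr sBA) cB subn_gt0.
rewrite inE => /andP[yB yA]; exists (y |: B).
by rewrite subUset sub1set yA sBA inE xB orbT cardsU1 yB cB.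
Qed.

Lemma skipK (D : finType) (p : {perm D}) r y : p r = r -> skip r (p * tperm r y) = p.
Proof.
move=> pr; rewrite /skip permM pr tpermL -permMA tperm2.
by apply/permP=> z; rewrite permM perm1.
Qed.

Lemma porbit_fix (D : finType) (p : {perm D}) x y : p x = x -> y \in porbit p x -> y = x.
Proof.
move=> px h; apply/eqP; apply: (porbit_ind (P := pred1 x)) h => /= [|z /eqP->] //.
by rewrite px.
Qed.

(** Off [A] the permutation p agrees with p0, whose values there already fill the complement of
    [A]. *)
Lemma perm_preserve (D : finType) (A : {set D}) (p p0 : {perm D}) y :
  (forall z, z \in A -> p0 z = z) -> (forall z, z \notin A -> p z = p0 z) ->
  y \in A -> p y \in A.
Proof.
move=> fixA eqp yA; apply: contraLR yA => npy.
set w := p0^-1 (p y); have ew : p0 w = p y by rewrite permKV.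
have nw : w \notin A by apply: contra npy => wA; rewrite -ew fixA.
by have /perm_inj <- : p w = p y by rewrite eqp.
Qed.

Section AddRootEdge.
Variables (D : finType) (a1 b1 : {perm D}) (x r s : D).
Hypotheses (a1K : involutive a1) (pl : planar_pair a1 b1).
Hypotheses (a1x : a1 x = x) (a1r : a1 r = r) (b1r : b1 r = r) (a1s : a1 s = s).
Hypotheses (nrx : r != x) (nsr : s != r) (nsx : s != x).
Hypothesis face : conn a1 b1 x s -> s \in porbit (a1 * b1) x.
Let a := a1 * tperm r s.
Let b := b1 * tperm r (b1 x).

Lemma add_bx : b x = r. Proof. by rewrite permM tpermR. Qed.
Lemma add_ar : a r = s. Proof. by rewrite permM a1r tpermL. Qed.
Lemma add_skip_a : skip r a = a1. Proof. exact: skipK. Qed.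
Lemma add_skip_b : skip r b = b1. Proof. exact: skipK. Qed.

Lemma add_aE y : a y = if y == r then s else if y == s then r else a1 y.
Proof.
rewrite permM; have [->|nr] := eqVneq y r; first by rewrite a1r tpermL.
have [->|ns] := eqVneq y s; first by rewrite a1s tpermR.
rewrite tpermD //; first by rewrite -{1}a1r (inj_eq perm_inj) eq_sym.
by rewrite -{1}a1s (inj_eq perm_inj) eq_sym.
Qed.

Lemma add_aK : involutive a.
Proof.
move=> y; rewrite !add_aE; have [->|nr] := eqVneq y r; first by rewrite (negPf nsr) eqxx.
have [->|ns] := eqVneq y s; first by rewrite eqxx.
rewrite -[X in a1 y == X]a1r (inj_eq perm_inj) (negPf nr).
by rewrite -[X in a1 y == X]a1s (inj_eq perm_inj) (negPf ns) a1K.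
Qed.

(** Inserting r next to x joins an isolated dart to a component. Linking r with s then joins two
    components or splits a common face; [face] provides the second alternative. *)
Lemma add_planar : planar_pair a b.
Proof.
have iso y : conn a1 b1 r y -> y = r by rewrite conn_sym => /isolated->.
have nb1x : b1 x != r by rewrite -[X in _ != X]b1r (inj_eq perm_inj) eq_sym.
have plb : planar_pair a1 b.
  apply: planar_joinr pl; last by apply/orP; left; apply: contra nb1x => /iso->.
  by rewrite porbit_sym; apply: contra nb1x => /porbit_fix->.
have -> : a = tperm r s * a1.
  apply/permP=> y; rewrite add_aE permM.
  by case: tpermP => [->|->|/eqP/negPf-> /eqP/negPf->]; rewrite ?eqxx ?(negPf nsr) ?a1s ?a1r.
apply: planar_joinl plb; first by apply: contra nsr => /porbit_fix->.
have [h|h] := boolP (conn a1 b1 x s); last first.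
  apply/orP; left; apply: contra h => h.
  have hx : conn a1 b x s.
    by apply: conn_trans h; rewrite -add_bx; apply/connr/conn_refl.
  have := skip_conn a1r _ hx; rewrite eq_sym nrx (negPf nsr) add_skip_b; exact.
apply/orP; right; have := face h.
rewrite -[in a1 * b1]add_skip_b -skip_mul // porbit_skip 1?eq_sym // !inE => /andP[_].
rewrite porbit_sym -eq_porbit_mem -(porbit_perm _ 1 x) expg1 permM a1x add_bx.
by rewrite eq_porbit_mem.
Qed.

End AddRootEdge.

Lemma represents_exists T : tvalid T ->
  forall (D : finType) (a0 b0 : {perm D}) (A : {set D}) x,
    planar_pair a0 b0 -> involutive a0 ->
    (forall y, y \in A -> a0 y = y) -> (forall y, y \in A -> b0 y = y) ->
    x \in A -> #|A| = (tedges T).*2.+1 ->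
  exists a b : {perm D},
    [/\ legged a b x, represents T a b x,
        forall y, conn a b x y = (y \in A),
        forall y, y \notin A -> a y = a0 y
      & forall y, y \notin A -> b y = b0 y].
Proof.
elim: T => [|T1 IH1 T2 IH2|T IH k] /= vT D a0 b0 A x pl0 a0K fa fb xA cA.
- have/cards1P[z eA] : #|A| == 1%N by rewrite cA.
  have ez : z = x by move: xA; rewrite eA inE => /eqP.
  have cE y : conn a0 b0 x y = (y \in A).
    rewrite eA ez inE; apply/idP/eqP => [|->]; last exact: conn_refl.
    by rewrite conn_sym => /isolated->; rewrite ?fa ?fb.
  exists a0, b0; split=> //; last exact: fb.
  split=> // y; rewrite cE eA inE => /eqP->; rewrite ez eqxx fa ?eqxx //.
- case/andP: vT => v1 v2.
  (* [A] is divided into r, a part [A1] with leg x and a part [A2] with leg s. The set [C] has #|A|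
     - 1 elements, as [subset_with_card] adds one to its argument. *)
  have [|C [sCA xC cC]] := @subset_with_card _ A x #|A|.-2 xA; first by rewrite cA; lia.
  have /set0Pn[r] : A :\: C != set0.
    by rewrite -card_gt0 cardsD (setIidPr sCA) cC cA; lia.
  rewrite inE => /andP[rC rA].
  have [|A1 [sA1 xA1 cA1]] := @subset_with_card _ C x (tedges T1).*2 xC.
    by rewrite cC cA; lia.
  pose A2 := C :\: A1.
  have cA2 : #|A2| = (tedges T2).*2.+1.
    by rewrite cardsD (setIidPr sA1) cC cA1 cA; lia.
  have /set0Pn[s sA2] : A2 != set0 by rewrite -card_gt0 cA2.
  have A1A y : y \in A1 -> y \in A by move/(subsetP sA1)/(subsetP sCA).
  have A2A y : y \in A2 -> y \in A by case/setDP=> /(subsetP sCA).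
  have A2n y : y \in A2 -> y \notin A1 by case/setDP.
  have rA1 : r \notin A1 by apply: contra rC; apply: (subsetP sA1).
  have rA2 : r \notin A2 by apply: contra rC => /setDP[].
  have [||a' [b' [G1 R1 c1 oa' ob']]] := IH1 v1 D a0 b0 A1 x pl0 a0K _ _ xA1 cA1.
  + by move=> y /A1A; apply: fa.
  + by move=> y /A1A; apply: fb.
  have [a'K pl' _] := G1.
  have [||a1 [b1 [G2 R2 c2 oa1 ob1]]] := IH2 v2 D a' b' A2 s pl' a'K _ _ sA2 cA2.
  + by move=> y yA; rewrite oa' ?fa ?A2n // A2A.
  + by move=> y yA; rewrite ob' ?fb ?A2n // A2A.
  (* The second construction leaves [A1] unchanged, so the identity carries the first map over. *)
  have I : iso_on (conn a' b' x) a' b' a1 b1 id.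
    have n2 y : conn a' b' x y -> y \notin A2 by rewrite c1 => h; apply: contraL h => /A2n.
    by split=> // y /n2 h; rewrite ?oa1 ?ob1.
  have R1' := represents_iso I R1.
  have c1' y : conn a1 b1 x y = (y \in A1).
    rewrite -c1; apply/idP/idP => [/(iso_conn_surj I (conn_refl _ _ _))[z hz ->] //|h].
    exact: (iso_conn I (conn_refl _ _ _) h).
  have [a1K pl1 fix2] := G2.
  have a1x : a1 x = x.
    by rewrite oa1 ?(root_fix G1) //; apply: contraL xA1 => /A2n.
  have a1r : a1 r = r by rewrite oa1 // oa' // fa.
  have b1r : b1 r = r by rewrite ob1 // ob' // fb.
  have a1s : a1 s = s := root_fix G2.
  have nrx : r != x by apply: contraNneq rA1 => ->.
  have nsr : s != r by apply: contraNneq rA2 => <-.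
  have nsA1 := A2n _ sA2.
  have nsx : s != x by apply: contraNneq nsA1 => ->.
  have ncs : ~~ conn a1 b1 x s by rewrite c1'.
  have face : conn a1 b1 x s -> s \in porbit (a1 * b1) x by rewrite (negPf ncs).
  pose a := a1 * tperm r s; pose b := b1 * tperm r (b1 x).
  have bx : b x = r by apply: add_bx.
  have ar : a r = s by apply: add_ar.
  have sa : skip r a = a1 by apply: add_skip_a.
  have sb : skip r b = b1 by apply: add_skip_b.
  have oa y : y \notin A -> a y = a0 y.
    move=> ny; have n2 : y \notin A2 by apply: contra ny; apply: A2A.
    have n1 : y \notin A1 by apply: contra ny; apply: A1A.
    rewrite /a add_aE // oa1 // oa' //.
    case: eqP ny => [->|_]; first by rewrite rA.
    by case: eqP => [->|//]; rewrite A2A.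
  have ob y : y \notin A -> b y = b0 y.
    move=> ny; have n2 : y \notin A2 by apply: contra ny; apply: A2A.
    have n1 : y \notin A1 by apply: contra ny; apply: A1A.
    have nby : b0 y \notin A by apply: contra ny => h; rewrite -(perm_inj (fb _ h)).
    rewrite /b permM (ob1 y n2) (ob' y n1) tpermD //; apply: contraNneq nby => <- //.
    by apply: A1A; rewrite -c1' connrE conn_refl.
  have cA' y : conn a b x y -> y \in A.
    by apply: (conn_ind (P := mem A)) => //= z; [apply: perm_preserve fa oa|apply: perm_preserve fb ob].
  have AE y : y \in A -> [|| y == r, y \in A1 | y \in A2].
    have e : A = r |: C.
      have leA : #|A| <= #|C|.+1 by rewrite cC cA; clear; lia.
      by apply/esym/eqP; rewrite eqEcard subUset sub1set rA sCA cardsU1 rC add1n.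
    by rewrite e !inE => /orP[->|->] //=; rewrite andbT orbN orbT.
  have G : legged a b x.
    split; [exact: add_aK|exact: add_planar|].
    move=> y /cA'/AE; rewrite /a add_aE //.
    have [->|nr /=] := eqVneq y r; first by rewrite (negPf nsr) (negPf nrx).
    have [->|ns] := eqVneq y s; first by rewrite eq_sym (negPf nsr) (negPf nsx).
    case/orP=> [h|h].
      rewrite oa1; last by apply: contraL h => /A2n.
      by have [_ _ ->] := G1; rewrite ?c1.
    rewrite fix2 ?c2 // (negPf ns).
    by apply/esym; apply: contraTF h => /eqP->; apply: contraL xA1 => /A2n.
  exists a, b; split=> //.
    by rewrite /= bx ar sa sb.
  move=> y; apply/idP/idP => [/cA' //|/AE h].
  by rewrite root_conn ?bx // ar sa sb c1' c2.
- case/and3P: vT => v k0 lek.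
  (* Here [A] is divided into r, s and the darts [B] of the smaller map. *)
  have [|C [sCA xC cC]] := @subset_with_card _ A x #|A|.-2 xA; first by rewrite cA; lia.
  have /set0Pn[r] : A :\: C != set0.
    by rewrite -card_gt0 cardsD (setIidPr sCA) cC cA; lia.
  rewrite inE => /andP[rC rA].
  have [|B [sBC xB cB]] := @subset_with_card _ C x (tedges T).*2 xC.
    by rewrite cC cA; lia.
  have /set0Pn[s] : C :\: B != set0.
    by rewrite -card_gt0 cardsD (setIidPr sBC) cC cB cA; lia.
  rewrite inE => /andP[sB sC]; have sA := subsetP sCA _ sC.
  have BA y : y \in B -> y \in A by move/(subsetP sBC)/(subsetP sCA).
  have rB : r \notin B by apply: contra rC; apply: (subsetP sBC).
  have [||a1 [b2 [G2 R2 c2 oa1 ob2]]] := IH v D a0 b0 B x pl0 a0K _ _ xB cB.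
  + by move=> y /BA; apply: fa.
  + by move=> y /BA; apply: fb.
  have [a1K pl2 fix2] := G2; have [_ _ deg2] := represents_counts R2 G2.
  have a1x : a1 x = x := root_fix G2.
  have a1r : a1 r = r by rewrite oa1 // fa.
  have a1s : a1 s = s by rewrite oa1 // fa.
  have b2r : b2 r = r by rewrite ob2 // fb.
  have b2s : b2 s = s by rewrite ob2 // fb.
  have nrx : r != x by apply: contraNneq rB => ->.
  have nsr : s != r by apply: contraNneq rC => <-.
  have nsx : s != x by apply: contraNneq sB => ->.
  (* The leg s is to be inserted just before the dart lying k - 1 steps before x on the outer face,
     which gives the piece containing x length k. *)
  pose phi := a1 * b2; pose y0 := (phi ^+ k.-1)^-1 x.
  have y0E : (phi ^+ k.-1) y0 = x by rewrite permKV.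
  have y0x : y0 \in porbit phi x by rewrite porbit_sym -y0E mem_porbit.
  have y0B : y0 \in B by rewrite -c2; apply: conn_porbit.
  have y0s : y0 != s by apply: contraNneq sB => <-.
  have y0r : y0 != r by apply: contraNneq rB => <-.
  pose b1 := b2 * tperm s y0.
  have sb1 : skip s b1 = b2 by apply: skipK.
  have b1s : b1 s = y0 by rewrite permM b2s tpermL.
  have b1r : b1 r = r by rewrite permM b2r tpermD.
  have sphi : skip s (a1 * b1) = phi by rewrite skip_mul // sb1.
  have pl1 : planar_pair a1 b1.
    apply: planar_joinr pl2.
      by rewrite porbit_sym; apply: contra y0s => /porbit_fix->.
    by apply/orP; left; rewrite conn_sym; apply: contra y0s => /isolated->.
  have psis : (a1 * b1) s = y0 by rewrite permM a1s.
  have sx : s \in porbit (a1 * b1) x.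
    have: y0 \in porbit (a1 * b1) x.
      by move: y0x; rewrite -sphi porbit_skip 1?eq_sym // inE => /andP[].
    have e := porbit_perm (a1 * b1) 1 s; rewrite expg1 in e.
    by rewrite -psis -!eq_porbit_mem e.
  have cs : conn a1 b1 x s := conn_porbit sx.
  pose a := a1 * tperm r s; pose b := b1 * tperm r (b1 x).
  have bx : b x = r by apply: add_bx.
  have ar : a r = s by apply: add_ar.
  have sa : skip r a = a1 by apply: add_skip_a.
  have sb : skip r b = b1 by apply: add_skip_b.
  have oa y : y \notin A -> a y = a0 y.
    move=> ny; have n1 : y \notin B by apply: contra ny; apply: BA.
    rewrite /a add_aE // oa1 //.
    case: eqP ny => [->|_]; first by rewrite rA.
    by case: eqP => [->|//]; rewrite sA.
  have b1x : b1 x \in A.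
    rewrite permM; case: tpermP => [_|_|_ _]; [exact: BA|exact: sA|].
    by apply: BA; rewrite -c2 connrE conn_refl.
  have ob y : y \notin A -> b y = b0 y.
    move=> ny; have n1 : y \notin B by apply: contra ny; apply: BA.
    have nby : b0 y \notin A by apply: contra ny => h; rewrite -(perm_inj (fb _ h)).
    have nt z : z \in A -> z != b0 y by move=> zA; apply: contraNneq nby => <-.
    have e1 : b1 y = b0 y by rewrite permM (ob2 y n1) tpermD ?nt // BA.
    by rewrite /b permM e1 tpermD ?nt.
  have cA' y : conn a b x y -> y \in A.
    by apply: (conn_ind (P := mem A)) => //= z; [apply: perm_preserve fa oa|apply: perm_preserve fb ob].
  have AE y : y \in A -> [|| y == r, y == s | y \in B].
    have e : A = r |: (s |: B).
      have leA : #|A| <= #|B|.+2 by rewrite cB cA; clear; lia.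
      apply/esym/eqP; rewrite eqEcard !subUset !sub1set rA sA /=.
      by rewrite (subset_trans sBC sCA) !cardsU1 !inE eq_sym (negPf nsr) (negPf rB) sB !add1n.
    by rewrite e !inE.
  have G : legged a b x.
    split; [exact: add_aK|exact: add_planar|].
    move=> y /cA'/AE; rewrite /a add_aE //.
    have [->|nr /=] := eqVneq y r; first by rewrite (negPf nsr) (negPf nrx).
    have [->|ns /= h] := eqVneq y s; first by rewrite eq_sym (negPf nsr) (negPf nsx).
    by rewrite fix2 ?c2.
  have nbx : b x != x by rewrite bx.
  exists a, b; split=> //; last first.
    move=> y; apply/idP/idP => [/cA' //|/AE h].
    by rewrite root_loop_conn ?bx // ar sa sb // sb1 c2.
  rewrite /= bx ar sa sb sb1; split=> //.
  rewrite root_card_face // bx ar sa sb; congr _.+1.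
  by apply: porbit_dist_card; rewrite ?psis ?sphi ?deg2 // eq_sym.
Qed.

(** * Rooted maps on ordinals *)

Section OptionPerm.
Variable D : finType.
Implicit Types (p q a b : {perm D}) (x y z : D).

Lemma omap_perm_inj p : injective (omap p).
Proof. by move=> [y|] [z|] //= [/perm_inj->]. Qed.

Definition operm p : {perm option D} := perm (@omap_perm_inj p).

Lemma operm_Some p y : operm p (Some y) = Some (p y). Proof. by rewrite permE. Qed.
Lemma operm_None p : operm p None = None. Proof. by rewrite permE. Qed.

Lemma opermM p q : operm (p * q) = operm p * operm q.
Proof.
by apply/permP=> -[y|]; rewrite permM ?operm_Some ?operm_None // permM.
Qed.

Lemma operm_ex (P : {perm option D}) : P None = None -> exists p, P = operm p.
Proof.
move=> PN; pose f y := odflt y (P (Some y)).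
have fE y : P (Some y) = Some (f y).
  rewrite /f; case e : (P (Some y)) => [//|].
  by have /perm_inj : P (Some y) = P None by rewrite e PN.
have fI : injective f.
  move=> y z e; have /perm_inj[] // : P (Some y) = P (Some z) by rewrite !fE e.
exists (perm fI); apply/permP=> -[y|]; rewrite ?operm_Some ?operm_None //.
by rewrite permE fE.
Qed.

Lemma iso_Some (Q : pred D) a b : iso_on Q a b (operm a) (operm b) Some.
Proof. by split=> [y z _ _ []|y _|y _] //; rewrite operm_Some. Qed.

Lemma conn_Some a b x y : conn (operm a) (operm b) (Some x) (Some y) = conn a b x y.
Proof.
have I := iso_Some (conn a b x) a b.
apply/idP/idP => [/(iso_conn_surj I (conn_refl _ _ _))[z hz [->]] //|].
exact: (iso_conn I (conn_refl _ _ _)).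
Qed.

Lemma conn_None a b x : conn (operm a) (operm b) (Some x) None = false.
Proof. by apply/negP=> /isolated; rewrite !operm_None => /(_ erefl erefl). Qed.

Lemma porbit_Some p y : porbit (operm p) (Some y) = Some @: porbit p y.
Proof.
have pX n : (operm p ^+ n) (Some y) = Some ((p ^+ n) y).
  by elim: n => [|n IH]; rewrite ?expg0 ?perm1 // !permXS IH operm_Some.
apply/setP=> z; apply/porbitP/imsetP => [[n ->]|[w /porbitP[n ->] ->]].
  by exists ((p ^+ n) y); rewrite ?mem_porbit.
by exists n.
Qed.

Lemma nc_operm p : nc (operm p) = (nc p).+1.
Proof.
have Some_inj : injective (@Some D) by move=> y z [].
pose F (Y : {set D}) := [set Some y | y in Y].
have -> : nc (operm p) = #|[set None] |: F @: porbits p|.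
  congr #|pred_of_set _|; apply/setP=> X; rewrite !inE.
  apply/imsetP/orP => [[[y|] _ ->]|[/eqP->|/imsetP[Y /imsetP[y _ ->] ->]]].
  - by right; apply/imsetP; exists (porbit p y); rewrite ?imset_f // porbit_Some.
  - left; apply/eqP/setP=> z; rewrite inE; apply/idP/eqP => [|->]; last exact: porbit_id.
    exact/porbit_fix/operm_None.
  - exists None => //; apply/setP=> z; rewrite inE; apply/eqP/idP => [->|]; first exact: porbit_id.
    exact/porbit_fix/operm_None.
  - by exists (Some y); rewrite ?porbit_Some.
rewrite cardsU1 card_imset; last exact: imset_inj.
suff -> : [set None] \notin F @: porbits p by rewrite add1n.
apply/imsetP=> -[Y _ /setP/(_ None)]; rewrite !inE eqxx => /esym/imsetP[] //.
Qed.

(** The isolated dart [None] adds one cycle to each of the three permutations, one dart and one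
    component, so the two sides balance. *)
Lemma planar_operm a b x : (forall y z, conn a b y z) ->
  planar_pair (operm a) (operm b) = (nc a + nc b + nc (a * b) == #|D| + 2).
Proof.
move=> cab; rewrite /planar_pair -opermM !nc_operm card_option.
have -> : ncc (operm a) (operm b) = 2.
  have -> : ncc (operm a) (operm b) =
      #|[set ccls (operm a) (operm b) None; ccls (operm a) (operm b) (Some x)]|.
    congr #|pred_of_set _|; apply/setP=> X; rewrite !inE.
    apply/imsetP/orP => [[[y|] _ ->]|[/eqP->|/eqP->]].
    - by right; rewrite ccls_eq conn_Some.
    - by left.
    - by exists None.
    - by exists (Some x).
  by rewrite cards2 ccls_eq conn_sym conn_None.
by apply/eqP/eqP; lia.
Qed.

End OptionPerm.

Lemma card_porbits_involution (D : finType) (a : {perm D}) :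
  involutive a -> (forall x, a x != x) -> #|D| = (nc a).*2.
Proof.
move=> aK na; have c2 x : #|porbit a x| = 2.
  apply: card_porbit_min => // [|m m0 m2]; first by rewrite !permXS expg0 perm1.
  by have -> : m = 1%N by [lia]; rewrite expg1.
rewrite -muln2 -cardsT /nc.
apply: card_uniform_partition => [A /imsetP[x _ ->] //|].
have -> : porbits a = orbit 'P <[a]> @: [set: D].
  by apply/setP=> X; apply/imsetP/imsetP => -[x _ ->]; exists x; rewrite ?inE ?porbitE.
by apply: orbit_partition; apply/actsP=> p _ x; rewrite !inE.
Qed.

(** [None] is a leg placed just before the root in clockwise order, hence in the outer face, where
    its face successor is the root. *)
Definition leg_rotation (D : finType) (sigma : {perm D}) (root : D) : {perm option D} :=
  operm sigma^-1 * tperm None (Some root).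

Section LegRotation.
Variables (D : finType) (sigma alpha : {perm D}) (root : D).
Let a := operm alpha.
Let b := leg_rotation sigma root.

Lemma leg_rotation_None : b None = Some root.
Proof. by rewrite permM operm_None tpermL. Qed.

Lemma skip_leg_rotation : skip None b = operm sigma^-1.
Proof. exact/skipK/operm_None. Qed.

Lemma card_leg_face : #|porbit (a * b) None| = #|porbit (alpha * sigma^-1) root|.+1.
Proof.
have e : (a * b) None = Some root by rewrite permM operm_None leg_rotation_None.
have h := porbit_perm (a * b) 1 None; rewrite expg1 e in h.
have := @porbit_skip _ None (a * b) (Some root) isT.
rewrite skip_mul ?operm_None // skip_leg_rotation -opermM porbit_Some h => e2.
rewrite (cardsD1 None) porbit_id -e2 card_imset ?add1n // => y z [].
by [].
Qed.

Lemma conn_rot : involutive alpha ->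
  conn alpha sigma^-1 =2 connect (fun x y => (y == sigma x) || (y == alpha x)).
Proof.
move=> aK x y; rewrite -[RHS]/(conn sigma alpha x y) [RHS]connC -[RHS]connV.
suff -> : alpha^-1 = alpha by [].
by apply/permP=> z; apply: (@perm_inj _ alpha); rewrite permKV aK.
Qed.

Lemma legged_leg_rotation : involutive alpha -> (forall x, alpha x != x) ->
  (forall x y, conn alpha sigma^-1 x y) ->
  nc sigma + nc (alpha * sigma^-1) = nc alpha + 2 ->
  legged a b None /\ forall y, conn a b None y.
Proof.
move=> aK na cab euler.
have pl : planar_pair a (operm sigma^-1).
  rewrite planar_operm // (card_porbits_involution aK na).
  by rewrite /nc porbitsV -/(nc _) -/(nc _) -/(nc _); apply/eqP; lia.
split; last first.
  have h y : conn a b (Some root) (Some y).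
    by apply: (@conn_skipr _ None); rewrite skip_leg_rotation conn_Some.
  have hN : conn a b None (Some root) by rewrite -leg_rotation_None connrE conn_refl.
  by case=> [y|]; [apply: conn_trans hN (h y)|apply: conn_refl].
split.
- by case=> [y|]; rewrite ?operm_None // !operm_Some aK.
(* The leg starts as a component of its own, so attaching it keeps the genus. *)
- apply: planar_joinr pl.
    by rewrite porbit_sym; apply/negP=> /porbit_fix; rewrite operm_None => /(_ erefl).
  by rewrite conn_sym conn_None.
- by case=> [y|] _; rewrite ?operm_None // operm_Some (inj_eq Some_inj) (negPf (na y)).
Qed.

End LegRotation.

Definition represents_map (T : tree) (M : rmap) : Prop :=
  match M with
  | VertexMap => T = Leaf
  | DartMap m sigma alpha root =>
      represents T (operm alpha) (leg_rotation sigma root) None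
  end.

Lemma valid_legged m (sigma alpha : {perm 'I_(2 * m.+1)}) root :
  valid_rmap (DartMap sigma alpha root) ->
  legged (operm alpha) (leg_rotation sigma root) None /\
  forall y, conn (operm alpha) (leg_rotation sigma root) None y.
Proof.
case=> aK [na [cab euler]]; apply: legged_leg_rotation => // x y.
by rewrite conn_rot.
Qed.

Lemma represents_map_counts T M : valid_rmap M -> represents_map T M ->
  [/\ tvalid T, tedges T = nedges M & tdeg T = outer_degree M].
Proof.
case: M => [_ ->//|m sigma alpha root vM R].
have [G cN] := valid_legged vM; have [v e d] := represents_counts R G.
have [aK [na _]] := vM; have := card_porbits_involution aK na.
rewrite card_ord => em; split=> //.
  have eT : ccls (operm alpha) (leg_rotation sigma root) None = setT.
    by apply/setP=> y; rewrite !inE cN.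
  by move: e; rewrite eT cardsT card_option card_ord em /nedges -/(nc alpha); lia.
by move: d; rewrite card_leg_face => -[].
Qed.

Lemma represents_map_total M : valid_rmap M -> exists T, represents_map T M.
Proof.
case: M => [_|m sigma alpha root vM]; first by exists Leaf.
by have [G _] := valid_legged vM; apply: represents_total G.
Qed.

Lemma represents_map_iso T M M' : map_iso M M' -> represents_map T M -> represents_map T M'.
Proof.
case: M M' => [|m s a r] [|m' s' a' r'] //= [f [fB [fr [fs fa]]]].
have fI := bij_inj fB.
apply: (@represents_iso _ _ _ _ _ _ _ None (omap f)).
split=> [[y|] [z|] _ _ //= [/fI->] //|[y|] _|[y|] _].
- by rewrite !operm_Some /= fa.
- by rewrite /= !operm_None.
- rewrite !permM !operm_Some -fr.
  have -> : s'^-1 (f y) = f (s^-1 y).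
    by apply: (@perm_inj _ s'); rewrite permKV -fs permKV.
  by rewrite (inj_tperm (f := omap f)) // => -[u|] [v|] //= [/fI->].
- by rewrite /= !leg_rotation_None /= fr.
Qed.

Lemma represents_map_unique T M M' : valid_rmap M -> valid_rmap M' ->
  represents_map T M -> represents_map T M' -> map_iso M M'.
Proof.
move=> vM vM' R R'; have [_ e _] := represents_map_counts vM R.
have [_ e' _] := represents_map_counts vM' R'; rewrite {}e in e'.
(* A map with darts has m + 1 edges, so equal trees force the same constructor and the same m. *)
have pos m (s a : {perm 'I_(2 * m.+1)}) r :
    valid_rmap (DartMap s a r) -> nedges (DartMap s a r) = m.+1.
  case=> aK [na _]; have := card_porbits_involution aK na.
  by rewrite card_ord /= -/(nc a); lia.
case: M M' vM vM' R R' e' => [|m s a r] [|m' s' a' r'] // vM vM' R R' em.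
- by rewrite (pos _ _ _ _ vM') in em.
- by rewrite (pos _ _ _ _ vM) in em.
rewrite (pos _ _ _ _ vM) (pos _ _ _ _ vM') in em; case: em => em.
have [G cN] := valid_legged vM; have [G' cN'] := valid_legged vM'.
have [g gN [gI ga gb]] := represents_unique G G' R R'.
have gInj : injective g by move=> y z; apply: gI.
pose f y := odflt r' (g (Some y)).
have gE y : g (Some y) = Some (f y).
  rewrite /f; case e : (g (Some y)) => [//|].
  by have /gInj : g (Some y) = g None by rewrite e gN.
have fI : injective f.
  by move=> y z e; have /gInj[] : g (Some y) = g (Some z) by rewrite !gE e.
have fr : f r = r'.
  by have := gb None (cN _); rewrite gN !leg_rotation_None gE => -[].
exists f; split; [|split=> //; split].
- by apply: inj_card_bij fI _; rewrite !card_ord em.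
- have fsV y : f (s^-1 y) = s'^-1 (f y).
    have I : iso_on predT (operm a) (leg_rotation s r) (operm a') (leg_rotation s' r') g.
      by split=> [u v _ _ /gInj|u _|u _] //; rewrite ?ga ?gb.
    have [_ _ h] := iso_on_skipr (r := None) (fun _ _ => isT) isT I.
    have := h (Some y) isT; rewrite gN !skip_leg_rotation gE !operm_Some gE.
    by case.
  by move=> y; apply: (@perm_inj _ s'^-1); rewrite -fsV !permK.
- by move=> y; have := ga (Some y) (cN _); rewrite gE !operm_Some gE => -[].
Qed.

Lemma represents_map_exists T : tvalid T ->
  exists2 M, valid_rmap M & represents_map T M.
Proof.
case en : (tedges T) => [|m] vT.
  by exists VertexMap => //=; case: T en {vT}.
have pl1 : planar_pair (1 : {perm option 'I_(2 * m.+1)}) 1.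
  by rewrite /planar_pair mulg1 ncc1 !nc1; apply/eqP; lia.
have [| | | | |a [b [G R cN _ _]]] := represents_exists vT (A := setT) (x := None) pl1.
- by move=> y; rewrite !perm1.
- by move=> y _; rewrite perm1.
- by move=> y _; rewrite perm1.
- by rewrite inE.
- by rewrite cardsT card_option card_ord en; lia.
have [aK pl fixN] := G; have aN := root_fix G.
have {}cN y : conn a b None y by rewrite cN inE.
have [alpha ea] := operm_ex aN.
have [rho er] := operm_ex (skip_id None b).
pose x0 : 'I_(2 * m.+1) := ord0.
(* The leg cannot be alone at its vertex, since it would then be isolated in a connected map that
   has other darts. *)
case eb : (b None) => [root|]; last first.
  have := cN (Some x0); rewrite conn_sym => /isolated; rewrite aN eb => /(_ erefl erefl).
  by [].
have eb' : b = leg_rotation rho^-1 root.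
  rewrite /leg_rotation invgK -er /skip eb -permMA tperm2.
  by apply/permP=> z; rewrite permM perm1.
have aK' : involutive alpha.
  by move=> y; have := aK (Some y); rewrite ea !operm_Some => -[].
have na y : alpha y != y.
  have := fixN (Some y) (cN _); rewrite ea operm_Some (inj_eq Some_inj).
  by move=> ->.
have cab y z : conn alpha rho y z.
  rewrite -conn_Some -ea -er.
  have h : conn a b (Some y) (Some z).
    by apply: conn_trans (cN _); rewrite conn_sym.
  by have := skip_conn aN (isT : Some y != None) h.
exists (DartMap rho^-1 alpha root); last by rewrite /= -ea -eb'.
split=> //; split=> //; split.
  by move=> y z; rewrite -conn_rot // invgK.
have := planar_skipr None pl; rewrite er ea planar_operm //.
have -> : face_perm rho^-1 alpha = alpha * rho by rewrite /face_perm invgK.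
rewrite (card_porbits_involution aK' na) porbitsV -/(nc rho) -/(nc alpha) -/(nc (alpha * rho)).
by move/eqP; lia.
Qed.

Theorem theorem4p13 (n d : nat) :
  exists f : term -> rmap,
    (forall t, NPT_nd n d t ->
       valid_rmap (f t) /\ nedges (f t) = n /\ outer_degree (f t) = d) /\
    (forall M, valid_rmap M -> nedges M = n -> outer_degree M = d ->
       exists2 t, NPT_nd n d t & map_iso (f t) M) /\
    (forall t t', NPT_nd n d t -> NPT_nd n d t' ->
       map_iso (f t) (f t') -> t = t').
Proof.
(* A term is sent to some map with the same tree; on terms that come from no tree the chosen value
   is arbitrary. *)
pose Q t M := exists T,
  [/\ tvalid T, t = term_of_tree T, valid_rmap M & represents_map T M].
pose f t := epsilon (inhabits VertexMap) (Q t).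
have fP T : tvalid T -> valid_rmap (f (term_of_tree T)) /\ represents_map T (f (term_of_tree T)).
  move=> vT; have [M vM R] := represents_map_exists vT.
  have /epsilon_spec : exists M, Q (term_of_tree T) M by exists M, T.
  move=> /(_ (inhabits VertexMap))[T' [vT' eT vf R']].
  (* The tree behind the chosen map has the same term as [T], so it is [T]. *)
  by rewrite -(term_of_tree_inj vT vT' eT) in R'.
exists f; split; [|split].
- move=> t /NPT_ndP[T [vT <- <- ->]]; have [vf R] := fP T vT.
  by have [_ -> ->] := represents_map_counts vf R.
- move=> M vM eM dM; have [T R] := represents_map_total vM.
  have [vT eT dT] := represents_map_counts vM R; have [vf R'] := fP T vT.
  exists (term_of_tree T); first by apply/NPT_ndP; exists T; rewrite eT dT.
  exact: represents_map_unique R' R.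
- move=> t t' /NPT_ndP[T [vT _ _ ->]] /NPT_ndP[T' [vT' _ _ ->]] I.
  have [vf R] := fP T vT; have [vf' R'] := fP T' vT'.
  have R2 := represents_map_iso I R.
  case: (f (term_of_tree T')) R' R2 => [|m s a r] /= R' R2; first by rewrite R' R2.
  by rewrite (represents_inj R2 R').
Qed.
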